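(* For $g>1$, the analytic continuation of the genus $g$ free energy of the resolved conifold, $$\tilde F^g(t)=\frac{(-1)^{g-1}B_{2g}}{2g\,(2g-2)!}\,\mathrm{Li}_{3-2g}(q),\qquad q=e^{2\pi i t},$$ to the regime $t\to0$ is given by $$\tilde{F}^g(t)= \frac{B_{2g}}{2g(2g-2)} \frac{1}{(2\pi t)^{2g-2}} + (-1)^g \frac{B_{2g} B_{2g-2}}{2g (2g-2)(2g-2)!} + \frac{B_{2g}}{2g(2g-2)!} \sum_{d=g}^{\infty} (-1)^{d+1} \frac{B_{2d}}{2d\,(2d-2g+2)!} (2\pi t)^{2d-2g+2}.$$
   Context: $B_n$ are the Bernoulli numbers, $\frac{w}{e^w-1}=\sum_{n\ge0}B_n\frac{w^n}{n!}$, and $\mathrm{Li}_s(z)=\sum_{n\ge1}z^n/n^s$ is the polylogarithm. $\tilde F^g$ is the contribution of non-constant maps to the genus $g$ Gromov-Witten potential of the resolved conifold $\mathcal{O}(-1)\oplus\mathcal{O}(-1)\to\mathbb{P}^1$, given as a series in $q$, and $t$ is the Kähler parameter of the $\mathbb{P}^1$. *)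

(* Defs.v *)
From Stdlib Require Import Reals ZArith.
From Coquelicot Require Import Coquelicot.

Open Scope C_scope.

Definition Cexp (z : C) : C :=
  (exp (Re z) * cos (Im z), exp (Re z) * sin (Im z))%R.

(** Sums [\sum_(n >= m) a n] of complex series. *)
Definition is_sum_from (m : nat) (a : nat -> C) (l : C) : Prop :=
  @is_series C_AbsRing C_NormedModule (fun k => a (m + k)%nat) l.

Definition converges_from (m : nat) (a : nat -> C) : Prop :=
  exists l, is_sum_from m a l.

(** As with Coquelicot's [Series], the value is meaningful only when the series
    converges. *)
Definition Sum_from (m : nat) (a : nat -> C) : C :=
  @iota C_CompleteNormedModule (is_sum_from m a).

(** The generating function [w / (e^w - 1)] has a removable singularity at
    [w = 0]; the expansion near [0] determines [B]. *)
Definition is_bernoulli (B : nat -> R) : Prop :=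
  exists r : R, (0 < r)%R /\
    forall w : C, w <> 0 -> (Cmod w < r)%R ->
      is_sum_from 0 (fun n => B n * (w ^ n / INR (fact n))) (w / (Cexp w - 1)).

Definition Li (s : Z) (z : C) : C :=
  Sum_from 1 (fun n => z ^ n / powerRZ (INR n) s).

Definition Ftilde (B : nat -> R) (g : nat) (t : C) : C :=
  ((-1) ^ (g - 1) * B (2 * g)%nat)
    / (INR (2 * g) * INR (fact (2 * g - 2)))
  * Li (3 - 2 * Z.of_nat g) (Cexp (2 * PI * Ci * t)).

Definition analytic_on (U : C -> Prop) (f : C -> C) : Prop :=
  forall z : C, U z ->
    exists (a : nat -> C) (r : R), (0 < r)%R /\
      forall w : C, (Cmod (w - z) < r)%R ->
        is_sum_from 0 (fun n => a n * (w - z) ^ n) (f w).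

(** [F] continues [f] analytically from [D] to the open set [U]; the values of
    [f] outside [D] and of [F] outside [U] are irrelevant. *)
Definition analytic_continuation
    (D : C -> Prop) (f : C -> C) (U : C -> Prop) (F : C -> C) : Prop :=
  open U /\ (forall z, D z -> U z) /\
  analytic_on U F /\ (forall z, D z -> F z = f z).

(** The half-plane [|e^(2 pi i t)| < 1], where [Li] is given by its series. *)
Definition upper_half_plane (t : C) : Prop := (0 < Im t)%R.

(** The punctured disc around [0] up to the next singularities [t = 1, -1] of
    the free energy. *)
Definition punctured_unit_disc (t : C) : Prop := t <> 0 /\ (Cmod t < 1)%R.

Definition small_t_term (B : nat -> R) (g : nat) (t : C) (d : nat) : C :=
  (-1) ^ (d + 1)
  * (B (2 * d)%nat / (INR (2 * d) * INR (fact (2 * d - 2 * g + 2))))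
  * (2 * PI * t) ^ (2 * d - 2 * g + 2).

(* Main.v *)
Require Import Defs.
From Stdlib Require Import Reals ZArith Lra Lia Classical.
From Coquelicot Require Import Coquelicot.

(** Put [k = 2g - 2]. Everything follows from Lipschitz' formula
      [sum_(m in Z) 1 / (t + m)^k = (-2 pi i)^k / (k-1)! * sum_(d >= 1) d^(k-1) q^d]
    for [Im t > 0]: its left-hand side is analytic off the integers, so it is the
    continuation, and the Taylor coefficients at [0] of the terms with [m <> 0] are zeta
    values. To prove it, [ell q = sum_d d^(k-1) q^d] satisfies
    [ell s + ell (- s) = 2^k * ell (s^2)]; iterating,
      [ell (q(t)) = 2^(-N k) * sum_(j mod 2^N) ell (q((t + j) / 2^N))],
    and since [ell] is rational with a pole of order [k] at [q = 1], Tannery's theorem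
    gives the sum over the lattice as [N] grows. The case [k = 2] at [2 pi i t = x < 0]
    reads [x^2 e^x / (e^x - 1)^2 = A - x A'] with [A = x / (e^x - 1)], and comparing
    coefficients expresses the even zeta values by Bernoulli numbers; this also gives the
    convergence for all [|t| < 1]. A continuation is unique by the identity theorem along
    segments. *)

Open Scope C_scope.

(** Two constraints shape the proof. Tannery's theorem needs one summable majorant for all [N], and
    the bound on [ell] near its pole is only as good as an inequality [|1 - e^w| >= c |w|], which
    fails near [w = 2 pi i]. The residues are therefore taken symmetrically about [0], so that
    [|Im w| <= 9/2 < 2 pi] throughout. Halving alone refines the lattice far enough, so only the two
    square roots [s] and [- s] are ever needed, and the limit of [ell] is taken along real multiples
    [h w] with [h = 2^(-N)]. The Bernoulli comparison is made at negative real [x]: there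
    [q = e^x < 1] puts [t] on the positive imaginary axis, the closed form [x / (e^x - 1)] is
    regular, and real differentiation of power series applies. In the final expansion the integer
    [0] contributes the pole, and the terms of the sum are the Taylor coefficients of even positive
    degree. The constant coefficient, which would be the term [d = g - 1], is the summand with
    [B_(2g-2)]. *)

(** * Complex series *)

(** Convertible to [is_sum_from 0 a l], so facts pass between the two forms without rewriting. *)
Definition cseries (a : nat -> C) (l : C) : Prop :=
  @is_series C_AbsRing C_NormedModule a l.

(** Sums over a half-open range, unlike [sum_n]: they split at any index without a correction, as
    the sums over [2^N] residues require. *)
Fixpoint psum (a : nat -> C) (n : nat) : C :=
  match n with O => 0 | S m => psum a m + a m end.

Lemma psum_ext (a b : nat -> C) (n : nat) :
  (forall i, (i < n)%nat -> a i = b i) -> psum a n = psum b n.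
Proof.
  induction n as [|n IH]; simpl; intros H; [reflexivity|].
  rewrite IH, H; auto.
Qed.

Lemma psum_plus (a b : nat -> C) (n : nat) :
  psum (fun i => a i + b i) n = psum a n + psum b n.
Proof. induction n as [|n IH]; simpl; [|rewrite IH]; ring. Qed.

Lemma psum_scal (c : C) (a : nat -> C) (n : nat) :
  psum (fun i => c * a i) n = c * psum a n.
Proof. induction n as [|n IH]; simpl; [|rewrite IH]; ring. Qed.

Lemma psum_add (a : nat -> C) (n m : nat) :
  psum a (n + m) = psum a n + psum (fun i => a (n + i)%nat) m.
Proof.
  induction m as [|m IH]; simpl.
  - rewrite Nat.add_0_r; ring.
  - rewrite Nat.add_succ_r; simpl; rewrite IH; ring.
Qed.

Lemma psum_S_l (a : nat -> C) (n : nat) :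
  psum a (S n) = a 0%nat + psum (fun i => a (S i)) n.
Proof. change (S n) with (1 + n)%nat; rewrite psum_add; simpl; ring. Qed.

Lemma psum_sum_n (a : nat -> C) (n : nat) :
  psum a (S n) = @sum_n C_AbelianMonoid a n.
Proof.
  induction n as [|n IH].
  - rewrite sum_O; simpl; ring.
  - rewrite sum_Sn, <- IH; reflexivity.
Qed.

Lemma Cmod_psum (a : nat -> C) (u : nat -> R) (n : nat) :
  (forall i, (i <= n)%nat -> (Cmod (a i) <= u i)%R) ->
  (Cmod (psum a (S n)) <= sum_f_R0 u n)%R.
Proof.
  induction n as [|n IH]; intros H.
  - simpl; replace (0 + a 0%nat) with (a 0%nat) by ring; auto.
  - change (psum a (S (S n))) with (psum a (S n) + a (S n)).
    simpl sum_f_R0.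
    eapply Rle_trans; [apply Cmod_triangle|].
    apply Rplus_le_compat; auto.
Qed.

Lemma cseries_lim (a : nat -> C) (l : C) :
  cseries a l <->
  (forall eps : R, (0 < eps)%R -> exists N, forall n, (N <= n)%nat ->
     (Cmod (psum a n - l) < eps)%R).
Proof.
  unfold cseries, is_series. split.
  - intros H eps Heps.
    pose proof (proj1 (@filterlim_locally_ball_norm C_AbsRing nat C_NormedModule
       eventually _ (sum_n a) l) H (mkposreal eps Heps)) as [N HN].
    exists (S N). intros n Hn. destruct n as [|n]; [lia|].
    specialize (HN n ltac:(lia)). rewrite psum_sum_n. exact HN.
  - intros H.
    apply (proj2 (@filterlim_locally_ball_norm C_AbsRing nat C_NormedModule
       eventually _ (sum_n a) l)).
    intros eps. destruct (H eps (cond_pos eps)) as [N HN].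
    exists N. intros n Hn. specialize (HN (S n) ltac:(lia)).
    rewrite psum_sum_n in HN. exact HN.
Qed.

Lemma Cmod_small_eq (x y : C) :
  (forall eps : R, (0 < eps)%R -> (Cmod (x - y) <= eps)%R) -> x = y.
Proof.
  intros H.
  assert (E : x - y = 0).
  { apply Cmod_eq_0. apply Rle_antisym; [|apply Cmod_ge_0].
    apply le_epsilon. intros e He. rewrite Rplus_0_l. auto. }
  replace x with (x - y + y) by ring. rewrite E. ring.
Qed.

Lemma Cmod_dist_triangle (x y z : C) :
  (Cmod (x - z) <= Cmod (x - y) + Cmod (y - z))%R.
Proof. replace (x - z) with ((x - y) + (y - z)) by ring. apply Cmod_triangle. Qed.

Lemma Cmod_dist_sym (x y : C) : Cmod (x - y) = Cmod (y - x).
Proof. rewrite <- Cmod_opp. f_equal. ring. Qed.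

Lemma cseries_unique (a : nat -> C) (l l' : C) :
  cseries a l -> cseries a l' -> l = l'.
Proof.
  rewrite !cseries_lim. intros H H'. apply Cmod_small_eq. intros e He.
  destruct (H (e / 2)%R ltac:(lra)) as [N HN].
  destruct (H' (e / 2)%R ltac:(lra)) as [N' HN'].
  specialize (HN (N + N')%nat ltac:(lia)). specialize (HN' (N + N')%nat ltac:(lia)).
  pose proof (Cmod_dist_triangle l (psum a (N + N')) l').
  rewrite (Cmod_dist_sym l (psum a _)) in H0. lra.
Qed.

Lemma Sum_from_unique (m : nat) (a : nat -> C) (l : C) :
  is_sum_from m a l -> Sum_from m a = l.
Proof.
  intros H. apply (@iota_unique C_AbsRing C_CompleteNormedModule (is_sum_from m a)); [|exact H].
  intros y Hy. exact (cseries_unique _ _ _ Hy H).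
Qed.

Lemma cseries_ext (a b : nat -> C) (l : C) :
  (forall n, a n = b n) -> cseries a l -> cseries b l.
Proof. exact (@is_series_ext C_AbsRing C_NormedModule a b l). Qed.

Lemma cseries_plus (a b : nat -> C) (l m : C) :
  cseries a l -> cseries b m -> cseries (fun n => a n + b n) (l + m).
Proof. exact (@is_series_plus C_AbsRing C_NormedModule a b l m). Qed.

Lemma cseries_scal (c : C) (a : nat -> C) (l : C) :
  cseries a l -> cseries (fun n => c * a n) (c * l).
Proof. exact (@is_series_scal C_AbsRing C_NormedModule c a l). Qed.

Lemma cseries_minus (a b : nat -> C) (l m : C) :
  cseries a l -> cseries b m -> cseries (fun n => a n - b n) (l - m).
Proof. exact (@is_series_minus C_AbsRing C_NormedModule a b l m). Qed.

Lemma cseries_incr (a : nat -> C) (l : C) :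
  cseries a l -> cseries (fun n => a (S n)) (l - a 0%nat).
Proof.
  intros H. apply (@is_series_incr_1 C_AbsRing C_NormedModule).
  change (cseries a (l - a 0%nat + a 0%nat)).
  replace (l - a 0%nat + a 0%nat) with l by ring. exact H.
Qed.

Lemma cseries_decr (a : nat -> C) (l : C) :
  cseries (fun n => a (S n)) l -> cseries a (l + a 0%nat).
Proof.
  intros H. apply (@is_series_decr_1 C_AbsRing C_NormedModule).
  change (cseries (fun n => a (S n)) (l + a 0%nat - a 0%nat)).
  replace (l + a 0%nat - a 0%nat) with l by ring. exact H.
Qed.

Lemma cseries_shift (a : nat -> C) (l : C) (n : nat) :
  cseries a l -> cseries (fun k => a (n + k)%nat) (l - psum a n).
Proof.
  intros H. induction n as [|n IH].
  - replace (l - psum a 0) with l by (simpl; ring). exact H.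
  - apply cseries_incr in IH. rewrite Nat.add_0_r in IH.
    replace (l - psum a (S n)) with (l - psum a n - a n) by (simpl; ring).
    eapply cseries_ext; [|exact IH]. intros k; simpl. f_equal; lia.
Qed.

Lemma cseries_0 : cseries (fun _ => 0) 0.
Proof.
  apply cseries_lim. intros e He. exists 0%nat. intros n _.
  assert (E : psum (fun _ => 0) n = 0).
  { induction n as [|n IH]; simpl; [reflexivity|rewrite IH; ring]. }
  rewrite E. replace (0 - 0) with (RtoC 0) by ring. rewrite Cmod_0; exact He.
Qed.

Lemma cseries_abs (a : nat -> C) (u : nat -> R) :
  (forall n, (Cmod (a n) <= u n)%R) -> ex_series u -> exists l, cseries a l.
Proof.
  intros H Hu.
  exact (@ex_series_le C_AbsRing C_CompleteNormedModule a u H Hu).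
Qed.

Lemma sum_le_Series (u : nat -> R) (n : nat) :
  (forall i, (0 <= u i)%R) -> ex_series u -> (sum_f_R0 u n <= Series u)%R.
Proof.
  intros Hp Hu. rewrite (Series_incr_n u (S n)); [|lia|exact Hu]. simpl pred.
  assert (0 <= Series (fun k => u (S n + k)%nat))%R; [|lra].
  rewrite <- (Rmult_0_l (Series (fun k => u (S n + k)%nat))).
  rewrite <- Series_scal_l. apply Series_le.
  - intros k. rewrite Rmult_0_l. split; [lra|apply Hp].
  - apply (ex_series_incr_n u (S n)); exact Hu.
Qed.

Lemma cseries_bound (a : nat -> C) (u : nat -> R) (l : C) :
  (forall n, (Cmod (a n) <= u n)%R) -> ex_series u -> cseries a l ->
  (Cmod l <= Series u)%R.
Proof.
  intros H Hu Hl. apply le_epsilon. intros e He.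
  rewrite cseries_lim in Hl. destruct (Hl e He) as [N HN].
  specialize (HN (S N) ltac:(lia)).
  assert (Hp : forall i, (0 <= u i)%R).
  { intros i. eapply Rle_trans; [apply Cmod_ge_0|apply H]. }
  pose proof (Cmod_psum a u N (fun i _ => H i)).
  pose proof (sum_le_Series u N Hp Hu).
  pose proof (Cmod_triangle (psum a (S N)) (l - psum a (S N))) as T.
  replace (psum a (S N) + (l - psum a (S N))) with l in T by ring.
  rewrite (Cmod_dist_sym l) in T. lra.
Qed.

Lemma series_tail (u : nat -> R) :
  ex_series u -> forall eps : R, (0 < eps)%R -> exists N, forall n, (N <= n)%nat ->
    (Rabs (Series (fun k => u (n + k)%nat)) < eps)%R.
Proof.
  intros Hu eps He.
  pose proof (Series_correct u Hu) as Hs. apply is_series_Reals in Hs.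
  destruct (Hs eps He) as [N HN]. exists (S N). intros n Hn.
  rewrite (Series_incr_n u n) in HN; [|lia|exact Hu].
  specialize (HN (pred n) ltac:(lia)). unfold Rdist in HN.
  rewrite <- Rabs_Ropp.
  match goal with |- (Rabs ?x < _)%R => match type of HN with (Rabs ?y < _)%R =>
    replace x with y by ring end end. exact HN.
Qed.

(** Serves twice: for the cancellation of odd powers in [ell s + ell (- s)], and for the Laurent
    series of an even lattice sum. *)
Lemma cseries_even (a : nat -> C) (l : C) :
  (forall n, a (2 * n + 1)%nat = 0) -> cseries a l -> cseries (fun n => a (2 * n)%nat) l.
Proof.
  intros H. rewrite !cseries_lim. intros Hl e He.
  destruct (Hl e He) as [N HN]. exists N. intros n Hn.
  replace (psum (fun n => a (2 * n)%nat) n) with (psum a (2 * n)).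
  - apply HN; lia.
  - clear - H. induction n as [|n IH]; [reflexivity|].
    replace (2 * S n)%nat with (S (S (2 * n))) by lia.
    change (psum a (S (S (2 * n)))) with (psum a (2 * n) + a (2 * n)%nat + a (S (2 * n))).
    rewrite IH. replace (S (2 * n)) with (2 * n + 1)%nat by lia. rewrite H.
    change (psum (fun n => a (2 * n)%nat) (S n))
      with (psum (fun n => a (2 * n)%nat) n + a (2 * n)%nat). ring.
Qed.

(** The majorant is a product, so the remainders of the inner series are uniformly
    small and no general double-series theorem is needed. *)
Lemma cseries_exchange (a : nat -> nat -> C) (u v : nat -> R) (A B : nat -> C) (l : C) :
  (forall j n, (Cmod (a j n) <= u j * v n)%R) ->
  (forall j, (0 <= u j)%R) -> (forall n, (0 <= v n)%R) ->
  ex_series u -> ex_series v ->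
  (forall j, cseries (a j) (A j)) ->
  (forall n, cseries (fun j => a j n) (B n)) ->
  cseries A l -> cseries B l.
Proof.
  intros Ha Hpu Hpv Hu Hv HA HB Hl.
  apply cseries_lim. intros e He.
  assert (Hs : (0 <= Series u)%R).
  { eapply Rle_trans; [|apply (sum_le_Series u 0 Hpu Hu)]. apply Hpu. }
  destruct (series_tail v Hv (e / (Series u + 1))%R) as [N HN].
  { apply Rdiv_lt_0_compat; lra. }
  exists N. intros n Hn. specialize (HN n Hn).
  set (T := Series (fun k => v (n + k)%nat)) in *.
  assert (H1 : cseries (fun j => psum (a j) n) (psum B n)).
  { clear - HB. induction n as [|n IH]; simpl.
    - apply cseries_0.
    - apply cseries_plus; auto. }
  assert (H2 : forall j, (Cmod (A j - psum (a j) n) <= u j * T)%R).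
  { intros j.
    pose proof (cseries_shift _ _ n (HA j)) as E.
    unfold T. rewrite <- Series_scal_l.
    eapply cseries_bound; [|apply (@ex_series_scal_l R_AbsRing R_NormedModule (u j))|exact E].
    - intros k; apply Ha.
    - apply (ex_series_incr_n v n), Hv. }
  rewrite Cmod_dist_sym.
  apply Rle_lt_trans with (Series (fun j => u j * T))%R.
  - eapply cseries_bound; [exact H2|apply ex_series_scal_r, Hu|].
    apply cseries_minus; assumption.
  - rewrite Series_scal_r.
    apply Rle_lt_trans with (Series u * Rabs T)%R.
    { apply Rmult_le_compat_l; [exact Hs|apply Rle_abs]. }
    apply Rle_lt_trans with (Series u * (e / (Series u + 1)))%R.
    { apply Rmult_le_compat_l; lra. }
    replace e with ((Series u + 1) * (e / (Series u + 1)))%R at 2 by (field; lra).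
    apply Rmult_lt_compat_r; [apply Rdiv_lt_0_compat|]; lra.
Qed.

(** * Limits of complex sequences and Tannery's theorem *)

Definition cv (f : nat -> C) (l : C) : Prop :=
  forall eps : R, (0 < eps)%R -> exists N, forall n, (N <= n)%nat -> (Cmod (f n - l) < eps)%R.

Lemma cv_plus (f g : nat -> C) (l m : C) :
  cv f l -> cv g m -> cv (fun n => f n + g n) (l + m).
Proof.
  intros H H' e He.
  destruct (H (e / 2)%R ltac:(lra)) as [N HN].
  destruct (H' (e / 2)%R ltac:(lra)) as [N' HN'].
  exists (N + N')%nat. intros n Hn.
  specialize (HN n ltac:(lia)). specialize (HN' n ltac:(lia)).
  replace (f n + g n - (l + m)) with ((f n - l) + (g n - m)) by ring.
  pose proof (Cmod_triangle (f n - l) (g n - m)). lra.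
Qed.

Lemma cv_psum (f : nat -> nat -> C) (l : nat -> C) (J : nat) :
  (forall j, cv (fun n => f n j) (l j)) -> cv (fun n => psum (f n) J) (psum l J).
Proof.
  intros H. induction J as [|J IH].
  - intros e He. exists 0%nat. intros n _. simpl.
    replace (0 - 0) with (RtoC 0) by ring. rewrite Cmod_0. exact He.
  - apply (cv_plus _ _ _ _ IH (H J)).
Qed.

(** Tannery's theorem, for finite sums with a common value. *)
Lemma tannery (f : nat -> nat -> C) (l : nat -> C) (u : nat -> R) (M : nat -> nat) (s : C)
    (N0 : nat) :
  (forall N j, (N0 <= N)%nat -> (j < M N)%nat -> (Cmod (f N j) <= u j)%R) ->
  (forall j, (0 <= u j)%R) ->
  ex_series u ->
  (forall N, (N <= M N)%nat) ->
  (forall j, cv (fun N => f N j) (l j)) ->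
  (forall N, (N0 <= N)%nat -> psum (f N) (M N) = s) ->
  cseries l s.
Proof.
  intros Hf Hpu Hu HM Hl Hs. apply cseries_lim. intros e He.
  destruct (series_tail u Hu (e / 2)%R ltac:(lra)) as [J0 HJ0].
  exists J0. intros J HJ. specialize (HJ0 J HJ).
  destruct (cv_psum f l J Hl (e / 2)%R ltac:(lra)) as [N1 HN1].
  (* The [+ 1] forces [M N > J], so that the tail is a nonempty sum, the only kind [Cmod_psum]
     bounds. *)
  set (N := (N0 + N1 + J + 1)%nat).
  specialize (HN1 N ltac:(lia)). specialize (HM N).
  rewrite <- (Hs N ltac:(lia)).
  rewrite Cmod_dist_sym in HN1.
  eapply Rle_lt_trans; [apply (Cmod_dist_triangle _ (psum (f N) J))|].
  assert (Cmod (psum (f N) J - psum (f N) (M N)) < e / 2)%R; [|lra].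
  replace (M N) with (J + (M N - J))%nat by lia.
  rewrite psum_add.
  match goal with |- (Cmod (?x - (?x + ?y)) < _)%R =>
    replace (x - (x + y)) with (- y) by ring end.
  rewrite Cmod_opp.
  assert (E : (M N - J = S (M N - J - 1))%nat) by lia. rewrite E.
  eapply Rle_lt_trans.
  { apply (Cmod_psum _ (fun i => u (J + i)%nat)). intros i Hi. apply Hf; lia. }
  eapply Rle_lt_trans; [|exact HJ0].
  eapply Rle_trans; [|apply Rle_abs].
  apply sum_le_Series; [intros; apply Hpu|].
  apply (ex_series_incr_n u J), Hu.
Qed.

(** * Generating functions of polynomial sequences *)

(** Ratio test: consecutive terms have quotient [(1 + 1/(n+1))^K r], which tends to [r]. The test
    requires nonzero terms, hence the separate case [r = 0]. *)
Lemma ex_series_poly_geom (K : nat) (r : R) :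
  (0 <= r < 1)%R -> ex_series (fun n => (INR (S n) ^ K * r ^ n)%R).
Proof.
  intros [H0 H1].
  assert (Hpos : forall n, (0 < INR (S n))%R) by (intros; apply lt_0_INR; lia).
  destruct (Req_dec r 0) as [->|Hr].
  - apply (ex_series_incr_1 (fun n => (INR (S n) ^ K * 0 ^ n)%R)).
    apply ex_series_ext with (fun _ => 0%R).
    + intros n. simpl. ring.
    + exists 0%R. apply is_series_Reals. intros e He. exists 0%nat. intros n _.
      rewrite <- sum_n_Reals, sum_n_const. unfold Rdist.
      rewrite Rmult_0_r, Rminus_0_r, Rabs_R0. exact He.
  - apply ex_series_ext with (fun n => Rabs (INR (S n) ^ K * r ^ n)).
    { intros n. apply Rabs_pos_eq. apply Rmult_le_pos; apply pow_le; [apply Rlt_le, Hpos|lra]. }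
    apply ex_series_DAlembert with r; [exact H1| |].
    + intros n. apply Rmult_integral_contrapositive_currified; apply pow_nonzero; [|lra].
      apply Rgt_not_eq, Hpos.
    + apply is_lim_seq_ext with (fun n => ((1 + / INR (S n)) ^ K * r)%R).
      * intros n. rewrite Rabs_pos_eq.
        -- rewrite (S_INR (S n)). simpl (r ^ S n)%R.
           replace (1 + / INR (S n))%R with ((INR (S n) + 1) * / INR (S n))%R
             by (field; apply Rgt_not_eq, Hpos).
           rewrite Rpow_mult_distr, pow_inv.
           field; repeat split; try apply pow_nonzero; try apply Rgt_not_eq, Hpos; lra.
        -- apply Rlt_le, Rdiv_lt_0_compat; apply Rmult_lt_0_compat; apply pow_lt;
             try apply Hpos; lra.
      * replace (Finite r) with (Finite ((1 + 0) ^ K * r)%R)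
          by (rewrite Rplus_0_r, pow1, Rmult_1_l; reflexivity).
        apply (is_lim_seq_mult' _ _ ((1 + 0) ^ K)%R r); [|apply is_lim_seq_const].
        assert (L : is_lim_seq (fun n => (1 + / INR (S n))%R) (1 + 0)%R).
        { apply (is_lim_seq_plus' _ _ 1%R 0%R); [apply is_lim_seq_const|].
          apply (is_lim_seq_incr_1 (fun n => (/ INR n)%R)).
          apply (is_lim_seq_inv INR p_infty); [apply is_lim_seq_INR|discriminate]. }
        clear - L. induction K as [|K IH]; simpl.
        -- apply is_lim_seq_const.
        -- apply (is_lim_seq_mult' _ _ (1 + 0)%R ((1 + 0) ^ K)%R); assumption.
Qed.

Definition poly_bounded (p : nat -> R) : Prop :=
  exists (K : nat) (M : R), forall n, (Rabs (p n) <= M * INR (S n) ^ K)%R.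

Lemma poly_bounded_summable (p : nat -> R) (r : R) :
  poly_bounded p -> (0 <= r < 1)%R ->
  ex_series (fun n => (Rabs (p n) * r ^ n)%R).
Proof.
  intros (K & M & H) Hr.
  apply (@ex_series_le R_AbsRing R_CompleteNormedModule _
    (fun n => (M * (INR (S n) ^ K * r ^ n))%R)).
  - intros n. change (Rabs (Rabs (p n) * r ^ n) <= M * (INR (S n) ^ K * r ^ n))%R.
    assert (0 <= r ^ n)%R by (apply pow_le; lra).
    rewrite Rabs_pos_eq.
    + rewrite <- Rmult_assoc. apply Rmult_le_compat_r; auto.
    + apply Rmult_le_pos; [apply Rabs_pos|assumption].
  - apply (@ex_series_scal_l R_AbsRing R_NormedModule M), ex_series_poly_geom, Hr.
Qed.

Lemma Cmod_lt_1_neq (q : C) : (Cmod q < 1)%R -> 1 - q <> 0.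
Proof.
  intros Hq E. replace q with (RtoC 1) in Hq.
  - rewrite Cmod_1 in Hq; lra.
  - replace q with (1 - (1 - q)) by ring. rewrite E; ring.
Qed.

(** [(1 - q) * sum p n q^n = p 0 + sum (p (n+1) - p n) q^(n+1)] *)
Lemma generating_difference (p : nat -> R) (q s : C) :
  poly_bounded p -> (Cmod q < 1)%R ->
  cseries (fun n => (p (S n) - p n)%R * q ^ S n) s ->
  cseries (fun n => p n * q ^ n) ((p 0%nat + s) / (1 - q)).
Proof.
  intros Hp Hq Hs.
  pose proof (Cmod_lt_1_neq q Hq) as Hq1.
  (* The polynomial bound gives a sum [L]; the shifted series minus [q] times the series then yields
     a linear equation that determines it. *)
  destruct (cseries_abs (fun n => p n * q ^ n) _
    (fun n => Req_le _ _ (eq_trans (Cmod_mult _ _)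
       (f_equal2 Rmult (Cmod_R (p n)) (Cmod_pow q n))))
    (poly_bounded_summable p (Cmod q) Hp (conj (Cmod_ge_0 q) Hq))) as [L HL].
  assert (E : s = L - p 0%nat * q ^ 0 - q * L).
  { apply (cseries_unique _ _ _ Hs).
    eapply cseries_ext; [|apply cseries_minus;
      [apply (cseries_incr _ _ HL)|apply (cseries_scal q _ _ HL)]].
    intros n. cbv beta. rewrite RtoC_minus, !Cpow_S. ring. }
  replace ((p 0%nat + s) / (1 - q)) with L; [exact HL|].
  rewrite E. simpl. field. exact Hq1.
Qed.

(** The binomial coefficient of [n + K] over [K], that is, the coefficient of [q^n] in
    [1 / (1 - q)^(K+1)]. In factorial form it matches the factorials of the free energy by
    [field]. *)
Definition binc (K n : nat) : R := (INR (fact (n + K)) / (INR (fact n) * INR (fact K)))%R.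

Lemma binc_pos (K n : nat) : (0 < binc K n)%R.
Proof.
  unfold binc. apply Rdiv_lt_0_compat; [|apply Rmult_lt_0_compat]; apply INR_fact_lt_0.
Qed.

Lemma binc_0_r (K : nat) : binc K 0 = 1%R.
Proof. unfold binc. simpl. field. apply INR_fact_neq_0. Qed.

Lemma binc_pascal (K n : nat) : (binc (S K) (S n) - binc (S K) n = binc K (S n))%R.
Proof.
  unfold binc. replace (n + S K)%nat with (S n + K)%nat by lia.
  replace (S n + S K)%nat with (S (S n + K)) by lia.
  rewrite (fact_simpl (S n + K)), (fact_simpl n), (fact_simpl K), !mult_INR.
  rewrite (S_INR (S n + K)), plus_INR, !S_INR.
  pose proof (INR_fact_neq_0 n). pose proof (INR_fact_neq_0 K).
  pose proof (pos_INR n). pose proof (pos_INR K).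
  field. repeat split; try assumption; lra.
Qed.

(** Pascal's rule reduces the step to [(n+1)^(K+1) + (n+2)^K <= (n+2)^(K+1)], and
    [(n+1)^K <= (n+2)^K] gives this. *)
Lemma binc_le (K n : nat) : (binc K n <= INR (S n) ^ K)%R.
Proof.
  revert n. induction K as [|K IH]; intros n.
  - unfold binc. rewrite Nat.add_0_r. simpl. right. field. apply INR_fact_neq_0.
  - induction n as [|n IHn].
    + rewrite binc_0_r, pow1. lra.
    + replace (binc (S K) (S n)) with (binc (S K) n + binc K (S n))%R
        by (rewrite <- binc_pascal; ring).
      specialize (IH (S n)).
      assert (INR (S n) ^ S K <= INR (S n) * INR (S (S n)) ^ K)%R.
      { rewrite <- tech_pow_Rmult. apply Rmult_le_compat_l; [apply pos_INR|].
        apply pow_incr. split; [apply pos_INR|apply le_INR; lia]. }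
      rewrite <- (tech_pow_Rmult (INR (S (S n)))), (S_INR (S n)) at 1. lra.
Qed.

Lemma binc_poly_bounded (K : nat) : poly_bounded (binc K).
Proof.
  exists K, 1%R. intros n. rewrite Rabs_pos_eq by apply Rlt_le, binc_pos.
  rewrite Rmult_1_l. apply binc_le.
Qed.

(** By Pascal's rule the differences of the coefficients at level [K + 1] are those at level [K], so
    each level divides by one more factor [1 - q]. *)
Lemma binomial_series (K : nat) (q : C) :
  (Cmod q < 1)%R -> cseries (fun n => binc K n * q ^ n) (/ (1 - q) ^ S K).
Proof.
  intros Hq. pose proof (Cmod_lt_1_neq q Hq) as H1.
  induction K as [|K IH].
  - replace (/ (1 - q) ^ 1) with ((binc 0 0%nat + 0) / (1 - q)).
    + apply generating_difference; [apply binc_poly_bounded|exact Hq|].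
      eapply cseries_ext; [|apply cseries_0].
      intros n. unfold binc. rewrite !Nat.add_0_r. simpl (fact 0).
      replace (_ - _)%R with 0%R; [ring|].
      simpl (INR 1). field. split; apply INR_fact_neq_0.
    + rewrite binc_0_r, Cpow_1_r. field. exact H1.
  - replace (/ (1 - q) ^ S (S K)) with
      ((binc (S K) 0%nat + (/ (1 - q) ^ S K - binc K 0%nat * q ^ 0)) / (1 - q)).
    + apply generating_difference; [apply binc_poly_bounded|exact Hq|].
      eapply cseries_ext; [|apply (cseries_incr _ _ IH)].
      intros n. simpl. rewrite binc_pascal. reflexivity.
    + rewrite !binc_0_r, (Cpow_S _ (S K)). simpl (q ^ 0).
      pose proof (Cpow_nz _ (S K) H1). field. split; assumption.
Qed.

(** [pclass n c p]: the [n]-th difference of [p] is the constant [c], so that [p] is a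
    polynomial of degree at most [n] with leading coefficient [c / n!]. *)
Fixpoint pclass (n : nat) (c : R) (p : nat -> R) : Prop :=
  match n with
  | O => forall d, p d = c
  | S m => pclass m c (fun d => p (S d) - p d)%R
  end.

Lemma pclass_ext (n : nat) (c : R) (p p' : nat -> R) :
  (forall d, p d = p' d) -> pclass n c p -> pclass n c p'.
Proof.
  revert p p'. induction n as [|n IH]; simpl; intros p p' E H.
  - intros d. rewrite <- E; auto.
  - eapply IH; [|exact H]. intros d; simpl. rewrite !E; reflexivity.
Qed.

Lemma pclass_plus (n : nat) (c c' : R) (p p' : nat -> R) :
  pclass n c p -> pclass n c' p' -> pclass n (c + c') (fun d => p d + p' d)%R.
Proof.
  revert p p'. induction n as [|n IH]; simpl; intros p p' H H'.
  - intros d. rewrite H, H'; reflexivity.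
  - eapply pclass_ext; [|exact (IH _ _ H H')]. intros d; simpl; ring.
Qed.

Lemma pclass_raise (n : nat) (c : R) (p : nat -> R) : pclass n c p -> pclass (S n) 0 p.
Proof.
  revert p. induction n as [|n IH]; intros p H.
  - simpl in *. intros d. rewrite !H. ring.
  - exact (IH _ H).
Qed.

(** Discrete Leibniz rule: the difference of [d p(d)] is [d Dp + Dp + p] with [Dp] the difference of
    [p]. The three terms contribute the constants [(n+1) c], [0] and [c]. *)
Lemma pclass_mult_INR (n : nat) (c : R) (p : nat -> R) :
  pclass n c p -> pclass (S n) (INR (S n) * c) (fun d => INR d * p d)%R.
Proof.
  revert p. induction n as [|n IH]; intros p H.
  - simpl in *. intros d. rewrite !H. destruct d; simpl; ring.
  - change (pclass (S n) (INR (S (S n)) * c)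
      (fun d => INR (S d) * p (S d) - INR d * p d)%R).
    replace (INR (S (S n)) * c)%R with (INR (S n) * c + (0 + c))%R
      by (rewrite (S_INR (S n)); ring).
    simpl in H.
    eapply pclass_ext; [|exact (pclass_plus _ _ _ _ _ (IH _ H)
      (pclass_plus _ _ _ _ _ (pclass_raise _ _ _ H) (H : pclass (S n) c p)))].
    intros d. cbv beta. rewrite S_INR. ring.
Qed.

Lemma pclass_pow (n : nat) : pclass n (INR (fact n)) (fun d => INR d ^ n)%R.
Proof.
  induction n as [|n IH].
  - simpl. reflexivity.
  - rewrite fact_simpl, mult_INR. apply pclass_mult_INR, IH.
Qed.

Lemma pclass_poly_bounded (n : nat) (c : R) (p : nat -> R) :
  pclass n c p -> poly_bounded p.
Proof.
  intros H. exists n. revert p H. induction n as [|n IH]; intros p H.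
  - exists (Rabs c). intros d. rewrite H. simpl. lra.
  - destruct (IH _ H) as [M HM]. exists (Rabs (p 0%nat) + Rabs M)%R.
    assert (HM0 : (0 <= Rabs M)%R) by apply Rabs_pos.
    assert (HP0 : (0 <= Rabs (p 0%nat))%R) by apply Rabs_pos.
    (* Telescoping writes [p d] as [p 0] plus [d] differences, each at most
       [Rabs M * INR (S d) ^ n]. *)
    assert (B : forall d, (Rabs (p d) <= Rabs (p 0%nat) + Rabs M * (INR d * INR (S d) ^ n))%R).
    { induction d as [|d IHd].
      - simpl (INR 0). lra.
      - replace (p (S d)) with (p d + (p (S d) - p d))%R by ring.
        eapply Rle_trans; [apply Rabs_triang|].
        specialize (HM d). cbv beta in HM.
        assert (M * INR (S d) ^ n <= Rabs M * INR (S (S d)) ^ n)%R.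
        { apply Rle_trans with (Rabs M * INR (S d) ^ n)%R.
          - apply Rmult_le_compat_r; [apply pow_le, pos_INR|apply Rle_abs].
          - apply Rmult_le_compat_l; [exact HM0|]. apply pow_incr.
            split; [apply pos_INR|apply le_INR; lia]. }
        assert (INR d * INR (S d) ^ n <= INR d * INR (S (S d)) ^ n)%R.
        { apply Rmult_le_compat_l; [apply pos_INR|]. apply pow_incr.
          split; [apply pos_INR|apply le_INR; lia]. }
        apply (Rmult_le_compat_l (Rabs M)) in H1; [|exact HM0].
        rewrite (S_INR d) at 1. lra. }
    intros d. eapply Rle_trans; [apply B|].
    assert (1 <= INR (S d) ^ n)%R.
    { apply pow_R1_Rle. rewrite S_INR. pose proof (pos_INR d). lra. }
    rewrite <- tech_pow_Rmult. rewrite S_INR in *. pose proof (pos_INR d).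
    set (y := ((INR d + 1) ^ n)%R) in *.
    assert (0 <= Rabs M * y)%R by (apply Rmult_le_pos; lra).
    assert (0 <= Rabs (p 0%nat) * (((INR d + 1) * y) - 1))%R.
    { apply Rmult_le_pos; [lra|nra]. }
    nra.
Qed.

(** The generating function is rational with a pole of order [n + 1] at [q = 1], whose
    leading coefficient is [c]. *)
Lemma pclass_generating (n : nat) (c : R) (p : nat -> R) :
  pclass n c p ->
  exists (P : C -> C) (M : R),
    (forall q, (Cmod q <= 1)%R -> (Cmod (P q - c) <= M * Cmod (1 - q))%R) /\
    (forall q, (Cmod q < 1)%R -> cseries (fun d => p d * q ^ d) (P q / (1 - q) ^ S n)).
Proof.
  revert p. induction n as [|n IH]; intros p H.
  - exists (fun _ => RtoC c), 0%R. split.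
    + intros q _. replace (c - c) with (RtoC 0) by ring. rewrite Cmod_0. lra.
    + intros q Hq. simpl in H.
      eapply cseries_ext; [|apply (cseries_scal c), (binomial_series 0 q Hq)].
      intros d. unfold binc. rewrite H, Nat.add_0_r. simpl (fact 0).
      replace (INR (fact d) / _)%R with 1%R; [ring|].
      simpl (INR 1). field. apply INR_fact_neq_0.
  - destruct (IH _ H) as (P & M & HM & HP).
    (* The numerator of [(p 0 + q P / (1-q)^(n+1)) / (1-q)]. Its distance to [c] has three parts:
       the first is controlled by [|1 - q| <= 2], the second by the bound on [P - c], and the third
       is [- c (1 - q)]. *)
    exists (fun q => p 0%nat * (1 - q) ^ S n + q * P q),
      (Rabs (p 0%nat) * 2 ^ n + Rabs M + Rabs c)%R. split.
    + intros q Hq. pose proof (Cmod_ge_0 (1 - q)) as H0.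
      replace (p 0%nat * (1 - q) ^ S n + q * P q - c) with
        (p 0%nat * (1 - q) ^ S n + (q * (P q - c) + - (c * (1 - q)))) by ring.
      eapply Rle_trans; [apply Cmod_triangle|].
      rewrite !Rmult_plus_distr_r, Rplus_assoc. apply Rplus_le_compat.
      * rewrite Cmod_mult, Cmod_R, Cmod_pow, <- tech_pow_Rmult.
        assert (Cmod (1 - q) <= 2)%R.
        { eapply Rle_trans; [apply Cmod_triangle|]. rewrite Cmod_opp, Cmod_1. lra. }
        assert (Cmod (1 - q) ^ n <= 2 ^ n)%R by (apply pow_incr; lra).
        rewrite Rmult_assoc. apply Rmult_le_compat_l; [apply Rabs_pos|].
        rewrite Rmult_comm. apply Rmult_le_compat_r; assumption.
      * eapply Rle_trans; [apply Cmod_triangle|]. apply Rplus_le_compat.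
        -- rewrite Cmod_mult. specialize (HM q Hq).
           pose proof (Cmod_ge_0 (P q - c)). pose proof (Cmod_ge_0 q).
           apply Rle_trans with (1 * Cmod (P q - c))%R.
           { apply Rmult_le_compat_r; assumption. }
           rewrite Rmult_1_l. eapply Rle_trans; [exact HM|].
           apply Rmult_le_compat_r; [assumption|apply Rle_abs].
        -- rewrite Cmod_opp, Cmod_mult, Cmod_R. lra.
    + intros q Hq. pose proof (Cmod_lt_1_neq q Hq) as H1.
      replace ((p 0%nat * (1 - q) ^ S n + q * P q) / (1 - q) ^ S (S n)) with
        ((p 0%nat + q * (P q / (1 - q) ^ S n)) / (1 - q)).
      * apply generating_difference; [exact (pclass_poly_bounded (S n) c p H)|exact Hq|].
        eapply cseries_ext; [|apply (cseries_scal q _ _ (HP q Hq))].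
        intros d. cbv beta. rewrite Cpow_S. ring.
      * rewrite (Cpow_S (1 - q) (S n)). pose proof (Cpow_nz _ (S n) H1).
        field. split; assumption.
Qed.

(** * The exponential and sums over the lattice *)

(** For [x >= 1], [1/x^2 <= 2 (1/x - 1/(x+1))], and the right-hand side telescopes. *)
Lemma ex_series_inv_sq : ex_series (fun n => (/ INR (S n) ^ 2)%R).
Proof.
  assert (Hpos : forall n, (0 < INR (S n))%R) by (intros; apply lt_0_INR; lia).
  apply (@ex_series_le R_AbsRing R_CompleteNormedModule _
    (fun n => (2 * (/ INR (S n) - / INR (S (S n))))%R)).
  - intros n. change (Rabs (/ INR (S n) ^ 2) <= 2 * (/ INR (S n) - / INR (S (S n))))%R.
    specialize (Hpos n). rewrite (S_INR (S n)).
    assert (H1 : (1 <= INR (S n))%R).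
    { rewrite S_INR. pose proof (pos_INR n). lra. }
    set (x := INR (S n)) in *.
    rewrite Rabs_pos_eq by (left; apply Rinv_0_lt_compat, pow_lt; exact Hpos).
    apply Rminus_le.
    replace (/ x ^ 2 - 2 * (/ x - / (x + 1)))%R with ((1 - x) / (x ^ 2 * (x + 1)))%R
      by (field; lra).
    apply Rmult_le_0_r; [lra|]. left. apply Rinv_0_lt_compat.
    apply Rmult_lt_0_compat; [apply pow_lt|]; lra.
  - apply (@ex_series_scal_l R_AbsRing R_NormedModule 2%R).
    exists 1%R. apply is_series_Reals.
    assert (E : forall n, sum_f_R0 (fun n => (/ INR (S n) - / INR (S (S n)))%R) n
                          = (1 - / INR (S (S n)))%R).
    { induction n as [|n IH].
      - simpl. field.
      - rewrite tech5, IH. ring. }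
    intros e He.
    assert (L : is_lim_seq (fun n => / INR (S (S n)))%R 0).
    { apply (is_lim_seq_incr_1 (fun n => (/ INR (S n))%R)).
      apply (is_lim_seq_incr_1 (fun n => (/ INR n)%R)).
      apply (is_lim_seq_inv INR p_infty); [apply is_lim_seq_INR|discriminate]. }
    apply is_lim_seq_Reals in L. destruct (L e He) as [N HN].
    exists N. intros n Hn. rewrite E. specialize (HN n Hn). unfold Rdist in *.
    rewrite <- Rabs_Ropp.
    replace (- (1 - / INR (S (S n)) - 1))%R with (/ INR (S (S n)) - 0)%R by ring.
    exact HN.
Qed.

Lemma ex_series_lattice (z : C) (d : R) (k : nat) :
  (0 < d)%R -> (forall j, (d <= Cmod (z + INR j))%R) -> (2 <= k)%nat ->
  ex_series (fun j => (/ Cmod (z + INR j) ^ k)%R).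
Proof.
  (* Adding [d] times [|z + j| >= j - |z|] to [|z| + 1] times [|z + j| >= d] gives
     [(d + |z| + 1) |z + j| >= d (j + 1)], which is where [c] comes from. *)
  intros Hd H Hk. set (c := (d / (d + Cmod z + 1))%R).
  pose proof (Cmod_ge_0 z) as Hz.
  assert (Hc : (0 < c)%R) by (apply Rdiv_lt_0_compat; lra).
  assert (Hb : forall j, (c * INR (S j) <= Cmod (z + INR j))%R).
  { intros j. specialize (H j).
    assert (INR j - Cmod z <= Cmod (z + INR j))%R.
    { pose proof (Cmod_triangle (z + INR j) (- z)) as T.
      replace (z + INR j + - z) with (RtoC (INR j)) in T by ring.
      rewrite Cmod_R, Cmod_opp, Rabs_pos_eq in T by apply pos_INR. lra. }
    unfold c. rewrite S_INR.
    apply Rmult_le_reg_r with (d + Cmod z + 1)%R; [lra|].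
    replace (d / (d + Cmod z + 1) * (INR j + 1) * (d + Cmod z + 1))%R
      with (d * (INR j + 1))%R by (field; lra).
    assert (d * (INR j - Cmod z) <= d * Cmod (z + INR j))%R
      by (apply Rmult_le_compat_l; lra).
    assert ((Cmod z + 1) * d <= (Cmod z + 1) * Cmod (z + INR j))%R
      by (apply Rmult_le_compat_l; lra).
    lra. }
  apply (@ex_series_le R_AbsRing R_CompleteNormedModule _
    (fun j => (/ c ^ k * / INR (S j) ^ 2)%R)).
  - intros j. change (Rabs (/ Cmod (z + INR j) ^ k) <= / c ^ k * / INR (S j) ^ 2)%R.
    assert (H1 : (1 <= INR (S j))%R).
    { rewrite S_INR. pose proof (pos_INR j). lra. }
    assert (H2 : (0 < c * INR (S j))%R) by (apply Rmult_lt_0_compat; lra).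
    rewrite Rabs_pos_eq.
    + rewrite <- Rinv_mult. apply Rinv_le_contravar.
      * apply Rmult_lt_0_compat; apply pow_lt; lra.
      * apply Rle_trans with ((c * INR (S j)) ^ k)%R.
        -- rewrite Rpow_mult_distr. apply Rmult_le_compat_l; [apply pow_le; lra|].
           apply Rle_pow; assumption.
        -- apply pow_incr. split; [lra|apply Hb].
    + left. apply Rinv_0_lt_compat, pow_lt. specialize (H j). lra.
  - apply (@ex_series_scal_l R_AbsRing R_NormedModule (/ c ^ k)%R), ex_series_inv_sq.
Qed.

(** * The complex exponential and its behaviour near zero *)

Lemma Cexp_plus (x y : C) : Cexp (x + y) = Cexp x * Cexp y.
Proof.
  unfold Cexp. destruct x as [a b], y as [c d]. simpl.
  rewrite exp_plus, cos_plus, sin_plus. unfold Cmult; simpl. f_equal; ring.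
Qed.

Lemma Cexp_0 : Cexp 0 = 1.
Proof. unfold Cexp. simpl. rewrite exp_0, cos_0, sin_0. unfold RtoC. f_equal; ring. Qed.

Lemma Cmod_Cexp (z : C) : Cmod (Cexp z) = exp (Re z).
Proof.
  unfold Cmod, Cexp. cbn [fst snd].
  replace (_ + _)%R with (exp (Re z) ^ 2)%R.
  - rewrite <- Rsqr_pow2. apply sqrt_Rsqr. left; apply exp_pos.
  - pose proof (sin2_cos2 (Im z)) as E. unfold Rsqr in E.
    transitivity (exp (Re z) ^ 2 * (sin (Im z) * sin (Im z) + cos (Im z) * cos (Im z)))%R;
      [rewrite E|]; ring.
Qed.

Lemma Cexp_R (x : R) : Cexp x = exp x.
Proof. unfold Cexp. simpl. rewrite cos_0, sin_0. unfold RtoC. f_equal; ring. Qed.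

Definition qexp (t : C) : C := Cexp (2 * PI * Ci * t).

Lemma qexp_arg (t : C) : 2 * PI * Ci * t = ((- (2 * PI * Im t))%R, (2 * PI * Re t)%R).
Proof. destruct t as [x y]. unfold Cmult, Ci, RtoC; simpl. f_equal; ring. Qed.

Lemma Cmod_qexp (t : C) : Cmod (qexp t) = exp (- (2 * PI * Im t)).
Proof. unfold qexp. rewrite Cmod_Cexp, qexp_arg. reflexivity. Qed.

Lemma Cmod_qexp_lt_1 (t : C) : (0 < Im t)%R -> (Cmod (qexp t) < 1)%R.
Proof.
  intros H. rewrite Cmod_qexp, <- exp_0. apply exp_increasing.
  pose proof PI_RGT_0. assert (0 < PI * Im t)%R by (apply Rmult_lt_0_compat; lra). lra.
Qed.

Lemma qexp_plus (s t : C) : qexp (s + t) = qexp s * qexp t.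
Proof. unfold qexp. rewrite <- Cexp_plus. f_equal. ring. Qed.

Lemma qexp_1 : qexp 1 = 1.
Proof.
  unfold qexp. rewrite qexp_arg. unfold Cexp. simpl.
  rewrite !Rmult_0_r, Ropp_0, Rmult_1_r, exp_0, cos_2PI, sin_2PI.
  unfold RtoC. f_equal; ring.
Qed.

Lemma qexp_half : qexp (/ 2) = - (1).
Proof.
  unfold qexp. replace (/ 2) with (RtoC (/ 2)) by (rewrite RtoC_inv; [reflexivity|lra]).
  rewrite qexp_arg. unfold Cexp. simpl.
  replace (2 * PI * / 2)%R with PI by field.
  rewrite !Rmult_0_r, Ropp_0, exp_0, cos_PI, sin_PI.
  unfold RtoC, Copp; simpl. f_equal; ring.
Qed.

(** Real increments suffice because [h] will be [2^(-N)]; so two real derivatives, of the real and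
    the imaginary part, replace a complex one. *)
Lemma Cexp_slope (w : C) (eps : R) : (0 < eps)%R ->
  exists delta : R, (0 < delta)%R /\ forall h : R, h <> 0%R -> (Rabs h < delta)%R ->
    (Cmod ((Cexp (h * w) - 1) / h - w) < eps)%R.
Proof.
  intros He. destruct w as [a b].
  assert (D1 : derivable_pt_lim (fun h => exp (h * a) * cos (h * b))%R 0 a).
  { apply is_derive_Reals. auto_derive; [exact I|].
    rewrite !Rmult_0_l, exp_0, cos_0, sin_0. ring. }
  assert (D2 : derivable_pt_lim (fun h => exp (h * a) * sin (h * b))%R 0 b).
  { apply is_derive_Reals. auto_derive; [exact I|].
    rewrite !Rmult_0_l, exp_0, cos_0, sin_0. ring. }
  destruct (D1 (eps / 2)%R ltac:(lra)) as [d1 H1].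
  destruct (D2 (eps / 2)%R ltac:(lra)) as [d2 H2].
  exists (Rmin d1 d2). split.
  { apply Rmin_glb_lt; apply cond_pos. }
  intros h Hh Hd.
  specialize (H1 h Hh (Rlt_le_trans _ _ _ Hd (Rmin_l _ _))).
  specialize (H2 h Hh (Rlt_le_trans _ _ _ Hd (Rmin_r _ _))).
  rewrite Rplus_0_l, !Rmult_0_l, exp_0 in H1, H2.
  rewrite cos_0 in H1. rewrite sin_0 in H2.
  set (x := ((exp (h * a) * cos (h * b) - 1 * 1) / h - a)%R) in *.
  set (y := ((exp (h * a) * sin (h * b) - 1 * 0) / h - b)%R) in *.
  replace ((Cexp (h * (a, b)) - 1) / h - (a, b)) with (RtoC x + Ci * RtoC y).
  - eapply Rle_lt_trans; [apply Cmod_triangle|].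
    rewrite Cmod_mult, Cmod_Ci, !Cmod_R. lra.
  - unfold x, y, Cexp, Cdiv, Cminus, Cplus, Copp, Cmult, Cinv, Ci, RtoC; simpl.
    replace (h * a - 0 * b)%R with (h * a)%R by ring.
    replace (h * b + 0 * a)%R with (h * b)%R by ring.
    f_equal; field; exact Hh.
Qed.

(** From [sin y >= y - y^3/6]: for [y <= 9/4] the factor [1 - y^2/6] is at least [15/96], rounded
    down to [15/100]. The range [9/4] is half the bound on [Im w] used below. *)
Lemma sin_lower (x : R) : (Rabs x <= 9 / 4)%R -> (15 / 100 * Rabs x <= Rabs (sin x))%R.
Proof.
  assert (P : forall y, (0 <= y <= 9 / 4)%R -> (15 / 100 * y <= sin y)%R).
  { intros y Hy.
    destruct (pre_sin_bound y 0 ltac:(lra) ltac:(lra)) as [H _].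
    unfold sin_approx, sin_term in H. simpl in H.
    assert (y * y <= 81 / 16)%R by nra.
    assert (y * (81 / 16 - y * y) >= 0)%R by nra. nra. }
  intros H. destruct (Rle_dec 0 x) as [H0|H0].
  - rewrite Rabs_pos_eq in * by assumption. specialize (P x ltac:(lra)).
    rewrite Rabs_pos_eq; lra.
  - rewrite (Rabs_left x) in * by lra. specialize (P (- x)%R ltac:(lra)).
    rewrite sin_neg in P. rewrite <- Rabs_Ropp, Rabs_pos_eq; lra.
Qed.

(** The lower bound [|1 - e^w| >= c |w|] behind the majorant for Tannery's theorem. It can hold
    because [9/2 < 2 pi] keeps [w] away from the other zeros of [1 - e^w]. *)
Lemma Cmod_one_minus_Cexp_lower (A a b : R) :
  (- A <= a <= 0)%R -> (Rabs b <= 9 / 2)%R ->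
  (15 / 100 * exp (- A) * Cmod (a, b) <= Cmod (1 - Cexp (a, b)))%R.
Proof.
  intros Ha Hb.
  assert (E0 : (0 < exp (- A))%R) by apply exp_pos.
  assert (E1 : (exp (- A) <= exp a)%R).
  { destruct (proj1 Ha) as [H| <-]; [left; apply exp_increasing; exact H|lra]. }
  assert (E2 : (exp (- A) <= 1)%R).
  { rewrite <- exp_0. destruct (Req_dec A 0) as [->|]; [rewrite Ropp_0; lra|].
    left. apply exp_increasing. lra. }
  (* Multiplying [1 - a <= e^(-a)] by [e^a] gives [- a e^a <= 1 - e^a]. *)
  assert (E3 : (- a * exp (- A) <= 1 - exp a)%R).
  { assert (1 - a <= exp (- a))%R.
    { destruct (Req_dec a 0) as [->|Hn]; [rewrite Ropp_0, exp_0; lra|].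
      left. pose proof (exp_ineq1 (- a) ltac:(lra)). lra. }
    assert (exp a * exp (- a) = 1)%R by (rewrite <- exp_plus, Rplus_opp_r; apply exp_0).
    assert (exp a * (1 - a) <= exp a * exp (- a))%R.
    { apply Rmult_le_compat_l; [left; apply exp_pos|lra]. }
    assert (- a * exp (- A) <= - a * exp a)%R by (apply Rmult_le_compat_l; lra). lra. }
  pose proof (sin_lower (b / 2)) as S1.
  replace (Rabs (b / 2)) with (Rabs b / 2)%R in S1
    by (unfold Rdiv; rewrite Rabs_mult, (Rabs_pos_eq (/ 2)); lra).
  specialize (S1 ltac:(lra)).
  assert (C1 : cos b = (1 - 2 * (sin (b / 2) * sin (b / 2)))%R).
  { replace b with (2 * (b / 2))%R at 1 by field. rewrite cos_2a_sin. ring. }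
  apply Rsqr_incr_0_var; [|apply Cmod_ge_0].
  rewrite !Rsqr_pow2, Rpow_mult_distr, !Cmod2_alt. simpl Re; simpl Im.
  unfold Cexp; simpl Re; simpl Im.
  set (s := sin (b / 2)) in *.
  (* The identity [|1 - e^(a+ib)|^2 = (1 - e^a)^2 + 4 e^a sin^2(b/2)] separates the two variables:
     [E3] bounds the first square, [sin_lower] the second. *)
  replace ((1 + - (exp a * cos b)) ^ 2 + (0 + - (exp a * sin b)) ^ 2)%R
    with ((1 - exp a) ^ 2 + 4 * exp a * (s * s))%R.
  2:{ pose proof (sin2_cos2 b) as T. unfold Rsqr in T.
      transitivity (1 - 2 * exp a * cos b + exp a ^ 2 * (sin b * sin b + cos b * cos b))%R;
        [rewrite T, C1|]; ring. }
  set (c := exp (- A)) in *. set (ea := exp a) in *.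
  assert (T1 : ((- a * c) ^ 2 <= (1 - ea) ^ 2)%R) by (apply pow_incr; split; [apply Rmult_le_pos; lra|lra]).
  assert (T2 : ((15 / 100 * (Rabs b / 2)) ^ 2 <= Rabs s ^ 2)%R).
  { apply pow_incr. split; [|exact S1]. pose proof (Rabs_pos b). lra. }
  rewrite <- (Rsqr_pow2 (Rabs s)), <- Rsqr_abs in T2. unfold Rsqr in T2.
  assert (T3 : (Rabs b ^ 2 = b ^ 2)%R) by apply pow2_abs.
  replace ((15 / 100 * (Rabs b / 2)) ^ 2)%R with ((15 / 100) ^ 2 / 4 * b ^ 2)%R in T2
    by (rewrite <- T3; field).
  assert (T4 : (c * c <= ea)%R) by nra.
  assert (T5 : (c * c * (4 * ((15 / 100) ^ 2 / 4 * b ^ 2)) <= 4 * ea * (s * s))%R).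
  { replace (4 * ea * (s * s))%R with (ea * (4 * (s * s)))%R by ring.
    apply Rmult_le_compat; try lra.
    - apply Rmult_le_pos; lra.
    - pose proof (pow2_ge_0 b). lra. }
  assert (0 <= (c * a) ^ 2)%R by apply pow2_ge_0.
  replace ((15 / 100 * c) ^ 2 * (a ^ 2 + b ^ 2))%R with
    ((15 / 100) ^ 2 * (c * a) ^ 2 + c * c * (4 * ((15 / 100) ^ 2 / 4 * b ^ 2)))%R by field.
  replace ((- a * c) ^ 2)%R with ((c * a) ^ 2)%R in T1 by ring.
  lra.
Qed.

(** * The distribution relation *)

Lemma cv_const (c : C) : cv (fun _ => c) c.
Proof.
  intros e He. exists 0%nat. intros n _. replace (c - c) with (RtoC 0) by ring.
  rewrite Cmod_0. exact He.
Qed.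

Lemma cv_mult (f g : nat -> C) (l m : C) :
  cv f l -> cv g m -> cv (fun n => f n * g n) (l * m).
Proof.
  intros H H' e He.
  pose proof (Cmod_ge_0 l) as Hl. pose proof (Cmod_ge_0 m) as Hm.
  set (d := Rmin 1 (e / (Cmod l + Cmod m + 1))%R).
  assert (Hd : (0 < d)%R) by (apply Rmin_glb_lt; [lra|apply Rdiv_lt_0_compat; lra]).
  destruct (H d Hd) as [N HN]. destruct (H' d Hd) as [N' HN'].
  exists (N + N')%nat. intros n Hn.
  specialize (HN n ltac:(lia)). specialize (HN' n ltac:(lia)).
  replace (f n * g n - l * m) with
    ((f n - l) * m + ((f n - l) * (g n - m) + l * (g n - m))) by ring.
  pose proof (Cmod_ge_0 (f n - l)) as P1. pose proof (Cmod_ge_0 (g n - m)) as P2.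
  set (x := Cmod (f n - l)) in *. set (y := Cmod (g n - m)) in *.
  assert (Hd1 : (d <= 1)%R) by apply Rmin_l.
  assert (Hd2 : (d * (Cmod l + Cmod m + 1) <= e)%R).
  { apply Rle_trans with (e / (Cmod l + Cmod m + 1) * (Cmod l + Cmod m + 1))%R.
    - apply Rmult_le_compat_r; [lra|apply Rmin_r].
    - right. field. lra. }
  eapply Rle_lt_trans; [apply Cmod_triangle|].
  eapply Rle_lt_trans; [apply Rplus_le_compat_l, Cmod_triangle|].
  rewrite !Cmod_mult. fold x y.
  assert (x * Cmod m <= d * Cmod m)%R by (apply Rmult_le_compat_r; lra).
  assert (Cmod l * y <= Cmod l * d)%R by (apply Rmult_le_compat_l; lra).
  assert (x * y <= x * 1)%R by (apply Rmult_le_compat_l; lra).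
  nra.
Qed.

Lemma cv_pow (f : nat -> C) (l : C) (k : nat) : cv f l -> cv (fun n => f n ^ k) (l ^ k).
Proof.
  intros H. induction k as [|k IH].
  - apply (cv_const 1).
  - exact (cv_mult _ _ _ _ H IH).
Qed.

Lemma cv_inv (f : nat -> C) (l : C) : l <> 0 -> cv f l -> cv (fun n => / f n) (/ l).
Proof.
  intros Hl H e He. pose proof (proj1 (Cmod_gt_0 l) Hl) as Hl0.
  set (d := Rmin (Cmod l / 2) (e * (Cmod l * Cmod l) / 2)%R).
  assert (Hd : (0 < d)%R).
  { apply Rmin_glb_lt; [lra|]. apply Rdiv_lt_0_compat; [|lra].
    apply Rmult_lt_0_compat; [lra|apply Rmult_lt_0_compat; lra]. }
  destruct (H d Hd) as [N HN]. exists N. intros n Hn. specialize (HN n Hn).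
  assert (Hd1 : (d <= Cmod l / 2)%R) by apply Rmin_l.
  assert (Hd2 : (d <= e * (Cmod l * Cmod l) / 2)%R) by apply Rmin_r.
  assert (Hf : (Cmod l / 2 < Cmod (f n))%R).
  { pose proof (Cmod_triangle (f n) (l - f n)) as T.
    replace (f n + (l - f n)) with l in T by ring.
    rewrite (Cmod_dist_sym l) in T. lra. }
  assert (Hfn : f n <> 0) by (apply Cmod_gt_0; lra).
  replace (/ f n - / l) with ((l - f n) / (f n * l)) by (field; auto).
  rewrite Cmod_div by (apply Cmult_neq_0; assumption).
  rewrite Cmod_mult, (Cmod_dist_sym l).
  apply Rmult_lt_reg_r with (Cmod (f n) * Cmod l)%R; [apply Rmult_lt_0_compat; lra|].
  unfold Rdiv. rewrite Rmult_assoc, Rinv_l, Rmult_1_r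
    by (apply Rmult_integral_contrapositive_currified; lra).
  apply Rlt_le_trans with d; [exact HN|].
  eapply Rle_trans; [exact Hd2|].
  replace (e * (Cmod l * Cmod l) / 2)%R with (e * (Cmod l / 2 * Cmod l))%R by field.
  apply Rmult_le_compat_l; [lra|]. apply Rmult_le_compat_r; lra.
Qed.

Lemma cv_ext (f g : nat -> C) (l : C) : (forall n, f n = g n) -> cv f l -> cv g l.
Proof.
  intros E H e He. destruct (H e He) as [N HN]. exists N. intros n Hn.
  rewrite <- E. auto.
Qed.

Definition half_pow (N : nat) : R := (/ 2 ^ N)%R.

Lemma half_pow_pos (N : nat) : (0 < half_pow N)%R.
Proof. apply Rinv_0_lt_compat, pow_lt. lra. Qed.

Lemma half_pow_S (N : nat) : half_pow N = (2 * half_pow (S N))%R.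
Proof. unfold half_pow. simpl. field. apply pow_nonzero. lra. Qed.

Lemma half_pow_small (e : R) : (0 < e)%R ->
  exists N0, forall N, (N0 <= N)%nat -> (half_pow N < e)%R.
Proof.
  intros He.
  destruct (pow_lt_1_zero (/ 2) ltac:(rewrite Rabs_pos_eq; lra) e He) as [N0 H].
  exists N0. intros N HN. unfold half_pow. rewrite <- pow_inv.
  eapply Rle_lt_trans; [apply Rle_abs|]. apply H. exact HN.
Qed.

Lemma cv_Cexp_slope (w : C) :
  cv (fun N => (Cexp (half_pow (S N) * w) - 1) / half_pow (S N)) w.
Proof.
  intros e He. destruct (Cexp_slope w e He) as (d & Hd & H).
  destruct (half_pow_small d Hd) as [N0 HN]. exists N0. intros N HN0.
  pose proof (half_pow_pos (S N)). apply H; [lra|].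
  rewrite Rabs_pos_eq by lra. apply HN. lia.
Qed.

Lemma RtoC_neq_0 (x : R) : x <> 0%R -> RtoC x <> 0.
Proof. intros H E. apply H, RtoC_inj, E. Qed.

Lemma psum_rev (a : nat -> C) (n : nat) :
  psum a n = psum (fun j => a (n - S j)%nat) n.
Proof.
  induction n as [|n IH]; [reflexivity|].
  rewrite (psum_S_l (fun j => a (S n - S j)%nat)).
  replace (S n - 1)%nat with n by lia.
  change (psum a (S n)) with (psum a n + a n). rewrite IH, Cplus_comm. reflexivity.
Qed.

Definition power_generating (K : nat) (ell : C -> C) : Prop :=
  forall q, (Cmod q < 1)%R -> cseries (fun d => (INR d ^ K)%R * q ^ d) (ell q).

(** Odd powers cancel; even ones double, and [(2n)^K = 2^K n^K] supplies the remaining factor. *)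
Lemma ell_duplication (K : nat) (ell : C -> C) (Hell : power_generating K ell) (s : C) :
  (Cmod s < 1)%R -> ell s + ell (- s) = 2 ^ S K * ell (s * s).
Proof.
  intros Hs.
  assert (Hs2 : (Cmod (s * s) < 1)%R).
  { rewrite Cmod_mult. pose proof (Cmod_ge_0 s). nra. }
  assert (Hs' : (Cmod (- s) < 1)%R) by (rewrite Cmod_opp; exact Hs).
  assert (P : forall n, ((- s) ^ (2 * n)) = s ^ (2 * n)).
  { intros n. rewrite !Cpow_mult_r. f_equal. simpl. ring. }
  pose proof (cseries_plus _ _ _ _ (Hell s Hs) (Hell (- s) Hs')) as H.
  apply cseries_even in H.
  - refine (cseries_unique _ _ _ H _).
    eapply cseries_ext; [|apply (cseries_scal (2 ^ S K) _ _ (Hell _ Hs2))].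
    intros n. cbv beta. rewrite P, Cpow_mult_r, mult_INR, Rpow_mult_distr, RtoC_mult, (RtoC_pow (INR 2)).
    simpl (INR 2). replace (1 + 1)%R with 2%R by ring.
    rewrite Cpow_S. replace (s ^ 2) with (s * s) by (simpl; ring). ring.
  - intros n. cbv beta. rewrite Nat.add_1_r, !Cpow_S, P. ring.
Qed.

Lemma ell_distribution (K : nat) (ell : C -> C) (Hell : power_generating K ell)
    (t : C) (N : nat) :
  (0 < Im t)%R ->
  psum (fun j => ell (qexp ((t + INR j) * half_pow N))) (2 ^ N)
    = (2 ^ S K) ^ N * ell (qexp t).
Proof.
  intros Ht. induction N as [|N IH].
  - simpl. unfold half_pow. simpl.
    replace ((t + 0) * (/ 1)%R) with t; [ring|].
    rewrite Rinv_1. ring.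
  - replace (2 ^ S N)%nat with (2 ^ N + 2 ^ N)%nat by (simpl; lia).
    rewrite psum_add, <- psum_plus, Cpow_S, <- Cmult_assoc, <- IH, <- psum_scal.
    apply psum_ext. intros j _.
    set (s := qexp ((t + INR j) * half_pow (S N))).
    assert (Hs : (Cmod s < 1)%R).
    { apply Cmod_qexp_lt_1. destruct t as [x y]. simpl in *.
      pose proof (half_pow_pos (S N)). ring_simplify. nra. }
    (* Adding [2^N] to [j] shifts the argument by [1/2], which changes the sign: [s] and [- s] are
       the two square roots of the value at level [N]. *)
    replace (qexp ((t + INR (2 ^ N + j)) * half_pow (S N))) with (- s).
    + rewrite (ell_duplication K ell Hell s Hs). unfold s. rewrite <- qexp_plus.
      f_equal. f_equal. f_equal. rewrite (half_pow_S N), RtoC_mult. ring.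
    + transitivity (qexp (/ 2) * s); [rewrite qexp_half; ring|].
      unfold s. rewrite <- qexp_plus. f_equal.
      rewrite plus_INR, pow_INR, RtoC_plus. simpl (INR 2).
      replace (1 + 1)%R with 2%R by ring.
      rewrite (Cmult_plus_distr_r t), Cplus_comm.
      replace ((t + ((2 ^ N)%R + INR j)) * half_pow (S N)) with
        ((t + INR j) * half_pow (S N) + ((2 ^ N) * half_pow (S N))%R)
        by (rewrite RtoC_mult; ring).
      replace (2 ^ N * half_pow (S N))%R with (/ 2)%R.
      * rewrite RtoC_inv by lra. ring.
      * unfold half_pow. simpl. field. apply pow_nonzero. lra.
Qed.

(** The upper half of the residues mod [2^(N+1)], read backwards, is [2^(N+1) - (j+1)], and period
    [1] of [qexp] turns it into [-(j+1)]. A fixed index now stands for a fixed integer at every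
    level, as a termwise limit requires. *)
Lemma ell_distribution_centered (K : nat) (ell : C -> C) (Hell : power_generating K ell)
    (t : C) (N : nat) :
  (0 < Im t)%R ->
  psum (fun j => half_pow (S N) ^ S K *
      (ell (qexp (half_pow (S N) * (t + INR j)))
       + ell (qexp (half_pow (S N) * (t - INR (S j)))))) (2 ^ N)
    = ell (qexp t).
Proof.
  intros Ht. rewrite psum_scal.
  pose proof (ell_distribution K ell Hell t (S N) Ht) as H.
  replace (2 ^ S N)%nat with (2 ^ N + 2 ^ N)%nat in H by (simpl; lia).
  rewrite psum_add in H.
  rewrite (psum_rev (fun i => ell (qexp ((t + INR (2 ^ N + i)) * half_pow (S N))))) in H.
  rewrite <- psum_plus in H.
  assert (H2 : (2 ^ S K) <> 0) by (apply Cpow_nz, RtoC_neq_0; lra).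
  replace (ell (qexp t)) with (/ (2 ^ S K) ^ S N * ((2 ^ S K) ^ S N * ell (qexp t)))
    by (field; apply Cpow_nz, H2).
  rewrite <- H. f_equal.
  - unfold half_pow. rewrite RtoC_inv by (apply pow_nonzero; lra).
    rewrite Cpow_inv, RtoC_pow by (apply RtoC_neq_0, pow_nonzero; lra).
    rewrite <- !Cpow_mult_r. f_equal. f_equal. lia.
  - apply psum_ext. intros j Hj. f_equal; [do 2 f_equal; ring|].
    f_equal.
    replace (half_pow (S N) * (t - INR (S j))) with
      ((t + INR (2 ^ N + (2 ^ N - S j))) * half_pow (S N) + - (1)).
    + rewrite qexp_plus. replace (qexp (- (1))) with (RtoC 1); [ring|].
      transitivity (qexp (- (1)) * qexp 1); [|rewrite qexp_1; ring].
      rewrite <- qexp_plus. replace (- (1) + 1) with (RtoC 0) by ring.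
      unfold qexp. rewrite Cmult_0_r, Cexp_0. reflexivity.
    + replace (2 ^ N + (2 ^ N - S j))%nat with (2 ^ S N - S j)%nat by (simpl; lia).
      rewrite minus_INR by (simpl; lia). rewrite pow_INR, RtoC_minus.
      simpl (INR 2). replace (1 + 1)%R with 2%R by ring.
      replace (RtoC 1) with (RtoC (2 ^ S N) * half_pow (S N)); [ring|].
      unfold half_pow. rewrite <- RtoC_mult, Rinv_r; [reflexivity|].
      apply pow_nonzero. lra.
Qed.

(** * Lipschitz' formula *)

Lemma Im_neq_0 (z : C) : Im z <> 0%R -> z <> 0.
Proof. intros H E. apply H. rewrite E. reflexivity. Qed.

Lemma Im_le_Cmod (z : C) : (Rabs (Im z) <= Cmod z)%R.
Proof. eapply Rle_trans; [apply Rmax_r|apply Rmax_Cmod]. Qed.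

Lemma two_pi_i_neq_0 : 2 * PI * Ci <> 0.
Proof.
  apply Im_neq_0. unfold Cmult, Ci, RtoC; simpl. pose proof PI_RGT_0. lra.
Qed.

Lemma power_generating_pole (K : nat) (ell : C -> C) :
  power_generating K ell ->
  exists (P : C -> C) (M : R), (0 <= M)%R /\
    (forall q, (Cmod q <= 1)%R -> (Cmod (P q - INR (fact K)) <= M * Cmod (1 - q))%R) /\
    (forall q, (Cmod q < 1)%R -> ell q = P q / (1 - q) ^ S K).
Proof.
  intros Hell. destruct (pclass_generating _ _ _ (pclass_pow K)) as (P & M & HM & HP).
  exists P, (Rabs M). repeat split.
  - apply Rabs_pos.
  - intros q Hq. eapply Rle_trans; [exact (HM q Hq)|].
    apply Rmult_le_compat_r; [apply Cmod_ge_0|apply Rle_abs].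
  - intros q Hq. exact (cseries_unique _ _ _ (Hell q Hq) (HP q Hq)).
Qed.

Lemma Im_half_pow (N : nat) (t : C) (x : R) :
  (0 < Im t)%R -> (0 < Im (half_pow N * (t + x)))%R.
Proof.
  intros Ht. destruct t as [a b]. simpl in *. pose proof (half_pow_pos N).
  ring_simplify. nra.
Qed.

(** With [h = 2^(-N-1)] and [w = 2 pi i (t + x)], [(1 - q) / h] tends to [- w] and the numerator
    [P q] to [K!], so the pole of order [K + 1] absorbs the factor [h^(K+1)]. *)
Lemma power_generating_pointwise (K : nat) (ell : C -> C) (t : C) (x : R) :
  power_generating K ell -> (0 < Im t)%R ->
  cv (fun N => half_pow (S N) ^ S K * ell (qexp (half_pow (S N) * (t + x))))
     (INR (fact K) * / (- (2 * PI * Ci * (t + x))) ^ S K).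
Proof.
  intros Hell Ht. destruct (power_generating_pole K ell Hell) as (P & M & HM0 & HM & HP).
  set (w := 2 * PI * Ci * (t + x)).
  assert (Hw : w <> 0).
  { apply Cmult_neq_0; [apply two_pi_i_neq_0|]. apply Im_neq_0. destruct t; simpl in *; lra. }
  set (q := fun N => qexp (half_pow (S N) * (t + x))).
  assert (Hq : forall N, (Cmod (q N) < 1)%R)
    by (intros N; apply Cmod_qexp_lt_1, Im_half_pow, Ht).
  assert (Eq : forall N, q N = Cexp (half_pow (S N) * w)).
  { intros N. unfold q, qexp, w. f_equal. ring. }
  pose proof (cv_Cexp_slope w) as Hs.
  assert (Hh : forall N, RtoC (half_pow (S N)) <> 0).
  { intros N. apply RtoC_neq_0, Rgt_not_eq, half_pow_pos. }
  assert (H0 : cv (fun N => 1 - q N) 0).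
  { replace (RtoC 0) with (w * 0) by ring.
    apply cv_ext with (fun N => (Cexp (half_pow (S N) * w) - 1) / half_pow (S N)
                                 * (- half_pow (S N))).
    - intros N. rewrite Eq. field. apply Hh.
    - apply cv_mult; [exact Hs|]. intros e He.
      destruct (half_pow_small e He) as [N0 HN]. exists N0. intros N HN'.
      replace (- half_pow (S N) - 0) with (- half_pow (S N)) by ring.
      rewrite Cmod_opp, Cmod_R, Rabs_pos_eq by (left; apply half_pow_pos). apply HN. lia. }
  apply cv_ext with (fun N => P (q N) *
    / ((- (1)) * ((Cexp (half_pow (S N) * w) - 1) / half_pow (S N))) ^ S K).
  - intros N. fold (q N). rewrite (HP _ (Hq N)), <- Eq.
    pose proof (Cmod_lt_1_neq _ (Hq N)) as H1.
    replace (- (1) * ((q N - 1) / half_pow (S N))) with ((1 - q N) * / half_pow (S N))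
      by (field; apply Hh).
    rewrite Cpow_mult_l, Cpow_inv by apply Hh.
    pose proof (Cpow_nz _ (S K) H1). pose proof (Cpow_nz _ (S K) (Hh N)).
    field. split; assumption.
  - apply cv_mult.
    + intros e He. destruct (H0 (e / (M + 1))%R) as [N0 HN].
      { apply Rdiv_lt_0_compat; lra. }
      exists N0. intros N HN'. specialize (HN N HN').
      replace (1 - q N - 0) with (1 - q N) in HN by ring.
      eapply Rle_lt_trans; [apply HM; left; apply Hq|].
      pose proof (Cmod_ge_0 (1 - q N)).
      apply Rle_lt_trans with ((M + 1) * Cmod (1 - q N))%R; [nra|].
      apply Rmult_lt_reg_l with (/ (M + 1))%R; [apply Rinv_0_lt_compat; lra|].
      rewrite <- Rmult_assoc, Rinv_l, Rmult_1_l by lra. unfold Rdiv in HN. lra.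
    + apply cv_inv.
      * apply Cpow_nz. intros E. apply Hw.
        replace w with (- - w) by ring. rewrite E. ring.
      * apply cv_pow. replace (- w) with (- (1) * w) by ring.
        apply cv_mult; [apply cv_const|exact Hs].
Qed.

(** The majorant for Tannery's theorem: [D] is independent of [N] and [x]. The numerator is at most
    [K! + 2 M] since [|1 - q| <= 2], and the denominator is bounded below by [c h |t + x|]. *)
Lemma power_generating_bound (K : nat) (ell : C -> C) (t : C) :
  power_generating K ell -> (0 < Im t)%R ->
  exists D : R, (0 <= D)%R /\ forall (N : nat) (x : R),
    (Rabs (half_pow (S N) * (Re t + x)) <= 9 / 16)%R ->
    (Cmod (half_pow (S N) ^ S K * ell (qexp (half_pow (S N) * (t + x))%C))
       <= D * / Cmod (t + x) ^ S K)%R.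
Proof.
  intros Hell Ht. destruct (power_generating_pole K ell Hell) as (P & M & HM0 & HM & HP).
  set (A := (2 * PI * Im t)%R).
  set (c := (15 / 100 * exp (- A) * (2 * PI))%R).
  pose proof PI_RGT_0 as Hpi. pose proof PI_4 as Hpi4.
  assert (Hc : (0 < c)%R).
  { unfold c. pose proof (exp_pos (- A)). apply Rmult_lt_0_compat; lra. }
  exists ((INR (fact K) + M * 2) / c ^ S K)%R. split.
  { apply Rmult_le_pos; [pose proof (pos_INR (fact K)); lra|].
    left. apply Rinv_0_lt_compat, pow_lt, Hc. }
  intros N x Hx. set (h := half_pow (S N)) in *.
  assert (Hh : (0 < h)%R) by apply half_pow_pos.
  assert (Hh1 : (h <= 1)%R).
  { unfold h, half_pow. rewrite <- Rinv_1. apply Rinv_le_contravar; [lra|].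
    apply pow_R1_Rle; lra. }
  set (q := qexp (h * (t + x))).
  assert (Hq : (Cmod q < 1)%R) by (apply Cmod_qexp_lt_1, Im_half_pow, Ht).
  assert (Hz : (0 < Cmod (t + x))%R).
  { apply Cmod_gt_0, Im_neq_0. destruct t; simpl in *; lra. }
  assert (H1 : (c * (h * Cmod (t + x)) <= Cmod (1 - q))%R).
  { unfold q, qexp. rewrite qexp_arg.
    set (a := (- (2 * PI * Im (h * (t + x))))%R). set (b := (2 * PI * Re (h * (t + x)))%R).
    replace (c * (h * Cmod (t + x)))%R with (15 / 100 * exp (- A) * Cmod (a, b))%R.
    - apply Cmod_one_minus_Cexp_lower.
      + unfold a, A. replace (Im (h * (t + x))) with (h * Im t)%R
          by (destruct t; simpl; ring).
        assert (0 <= h * Im t <= Im t)%R by nra. split; nra.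
      (* The bound [9/16] was chosen for this: [2 pi * 9/16 <= 9/2] because [PI <= 4]. *)
      + unfold b. replace (Re (h * (t + x))) with (h * (Re t + x))%R
          by (destruct t; simpl; ring).
        rewrite Rabs_mult, (Rabs_pos_eq (2 * PI)) by lra.
        pose proof (Rabs_pos (h * (Re t + x))). nra.
    - unfold a, b. rewrite <- qexp_arg, !Cmod_mult, Cmod_Ci, !Cmod_R.
      rewrite !Rabs_pos_eq by lra. unfold c. ring. }
  rewrite (HP q Hq). pose proof (Cmod_lt_1_neq q Hq) as Hn.
  assert (Hq1 : (Cmod (1 - q) <= 2)%R).
  { eapply Rle_trans; [apply Cmod_triangle|]. rewrite Cmod_opp, Cmod_1. lra. }
  assert (HPq : (Cmod (P q) <= INR (fact K) + M * 2)%R).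
  { replace (P q) with (INR (fact K) + (P q - INR (fact K))) by ring.
    eapply Rle_trans; [apply Cmod_triangle|].
    rewrite Cmod_R, Rabs_pos_eq by apply pos_INR. apply Rplus_le_compat_l.
    eapply Rle_trans; [apply HM; lra|]. apply Rmult_le_compat_l; assumption. }
  rewrite Cmod_mult, Cmod_pow, Cmod_R, (Rabs_pos_eq h) by lra.
  rewrite Cmod_div, Cmod_pow by (apply Cpow_nz, Hn).
  assert (Hpow : ((c * (h * Cmod (t + x))) ^ S K <= Cmod (1 - q) ^ S K)%R).
  { apply pow_incr. split; [|exact H1]. apply Rmult_le_pos; [lra|].
    apply Rmult_le_pos; lra. }
  assert (Hpos : (0 < (c * (h * Cmod (t + x))) ^ S K)%R).
  { apply pow_lt, Rmult_lt_0_compat; [|apply Rmult_lt_0_compat]; lra. }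
  apply Rle_trans with
    (h ^ S K * ((INR (fact K) + M * 2) * / (c * (h * Cmod (t + x))) ^ S K))%R.
  - apply Rmult_le_compat_l; [apply pow_le; lra|]. unfold Rdiv.
    apply Rmult_le_compat; [apply Cmod_ge_0| |exact HPq|].
    + left. apply Rinv_0_lt_compat. lra.
    + apply Rinv_le_contravar; assumption.
  - rewrite !Rpow_mult_distr. right. field.
    repeat split; apply pow_nonzero; lra.
Qed.

Lemma lipschitz (K : nat) (ell : C -> C) (t : C) :
  (1 <= K)%nat -> power_generating K ell -> (0 < Im t)%R ->
  cseries (fun j => / (t + INR j) ^ S K + / (t - INR (S j)) ^ S K)
    ((- (2 * PI * Ci)) ^ S K / INR (fact K) * ell (qexp t)).
Proof.
  intros HK Hell Ht.
  destruct (power_generating_bound K ell t Hell Ht) as (D & HD & Hb).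
  assert (Hd1 : forall j, (Im t <= Cmod (t + INR j))%R).
  { intros j. eapply Rle_trans; [|apply Im_le_Cmod]. eapply Rle_trans; [|apply Rle_abs].
    destruct t; simpl; lra. }
  assert (Hd2 : forall j, (Im t <= Cmod ((1 - t) + INR j))%R).
  { intros j. eapply Rle_trans; [|apply Im_le_Cmod]. rewrite <- Rabs_Ropp.
    eapply Rle_trans; [|apply Rle_abs]. destruct t; simpl; lra. }
  assert (Hc : - (2 * PI * Ci) <> 0).
  { intros E. apply two_pi_i_neq_0. replace (2 * PI * Ci) with (- - (2 * PI * Ci)) by ring.
    rewrite E. ring. }
  pose proof (Cpow_nz _ (S K) Hc) as HcK.
  assert (HfK : RtoC (INR (fact K)) <> 0) by (apply RtoC_neq_0, INR_fact_neq_0).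
  (* The reflection [t -> 1 - t] carries the positive integers to the nonpositive ones, so
     [ex_series_lattice] covers both halves. *)
  assert (Hm : forall j, t - INR (S j) = - ((1 - t) + INR j)).
  { intros j. rewrite S_INR, RtoC_plus. ring. }
  assert (N1 : forall j, t + INR j <> 0).
  { intros j. apply Cmod_gt_0. specialize (Hd1 j). lra. }
  assert (N2 : forall j, t - INR (S j) <> 0).
  { intros j. rewrite Hm. apply Cmod_gt_0. rewrite Cmod_opp. specialize (Hd2 j). lra. }
  apply cseries_ext with (fun j => (- (2 * PI * Ci)) ^ S K / INR (fact K) *
    (INR (fact K) * / (- (2 * PI * Ci * (t + INR j))) ^ S K
     + INR (fact K) * / (- (2 * PI * Ci * (t + (- INR (S j))%R))) ^ S K)).
  { intros j. rewrite RtoC_opp. specialize (N1 j). specialize (N2 j).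
    replace (- (2 * PI * Ci * (t + INR j))) with (- (2 * PI * Ci) * (t + INR j)) by ring.
    replace (- (2 * PI * Ci * (t + - INR (S j)))) with (- (2 * PI * Ci) * (t - INR (S j))) by ring.
    rewrite !(Cpow_mult_l (- (2 * PI * Ci))).
    apply (Cpow_nz _ (S K)) in N1, N2.
    set (x1 := (t + INR j) ^ S K) in *. set (x2 := (t - INR (S j)) ^ S K) in *.
    set (x3 := (- (2 * PI * Ci)) ^ S K) in *. field. auto. }
  apply cseries_scal.
  (* From [N0] on, [Re t] contributes less than [1/16] after scaling; the integers, of size at most
     [2^N], contribute at most [1/2]. Together they stay below [9/16]. *)
  destruct (half_pow_small (/ (16 * (Rabs (Re t) + 1)))%R) as [N0 HN0].
  { apply Rinv_0_lt_compat. pose proof (Rabs_pos (Re t)). lra. }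
  assert (Hrange : forall N x, (N0 <= N)%nat -> (Rabs x <= 2 ^ N)%R ->
            (Rabs (half_pow (S N) * (Re t + x)) <= 9 / 16)%R).
  { intros N x HN Hx. pose proof (half_pow_pos (S N)) as Hh. pose proof (Rabs_pos (Re t)) as Hr.
    rewrite Rabs_mult, (Rabs_pos_eq (half_pow (S N))) by lra.
    assert (Rabs (Re t + x) <= Rabs (Re t) + 2 ^ N)%R.
    { eapply Rle_trans; [apply Rabs_triang|]. lra. }
    assert (half_pow (S N) * 2 ^ N = / 2)%R.
    { unfold half_pow. simpl. field. apply pow_nonzero; lra. }
    specialize (HN0 (S N) ltac:(lia)).
    assert (half_pow (S N) * (16 * (Rabs (Re t) + 1)) < 1)%R.
    { apply Rmult_lt_reg_r with (/ (16 * (Rabs (Re t) + 1)))%R; [apply Rinv_0_lt_compat; lra|].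
      rewrite Rmult_assoc, Rinv_r, Rmult_1_r, Rmult_1_l by lra. exact HN0. }
    nra. }
  apply (tannery
    (fun N j => half_pow (S N) ^ S K *
      (ell (qexp (half_pow (S N) * (t + INR j)))
       + ell (qexp (half_pow (S N) * (t - INR (S j))))))
    _ (fun j => D * (/ Cmod (t + INR j)%C ^ S K + / Cmod (1 - t + INR j)%C ^ S K))%R
    (fun N => (2 ^ N)%nat) _ N0).
  - intros N j HN Hj.
    assert (Hj' : (INR (S j) <= 2 ^ N)%R).
    { replace 2%R with (INR 2) by (simpl; ring). rewrite <- pow_INR. apply le_INR. lia. }
    rewrite Cmult_plus_distr_l. eapply Rle_trans; [apply Cmod_triangle|].
    rewrite Rmult_plus_distr_l. apply Rplus_le_compat.
    + apply Hb, Hrange; [exact HN|]. rewrite Rabs_pos_eq by apply pos_INR.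
      rewrite S_INR in Hj'. lra.
    + assert (EE : Cmod (1 - t + INR j) = Cmod (t + (- INR (S j))%R)).
      { rewrite <- Cmod_opp, <- Hm, RtoC_opp. reflexivity. }
      rewrite EE. replace (t - INR (S j)) with (t + (- INR (S j))%R) by (rewrite RtoC_opp; reflexivity).
      apply Hb, Hrange; [exact HN|]. rewrite Rabs_Ropp, Rabs_pos_eq by apply pos_INR. exact Hj'.
  - intros j. apply Rmult_le_pos; [exact HD|].
    apply Rplus_le_le_0_compat; left; apply Rinv_0_lt_compat, pow_lt;
      [specialize (Hd1 j)|specialize (Hd2 j)]; lra.
  - apply (@ex_series_scal_l R_AbsRing R_NormedModule D).
    apply (@ex_series_plus R_AbsRing R_NormedModule); eapply ex_series_lattice; eauto; lia.
  - intros N. induction N as [|N IH]; simpl; [lia|]. pose proof (Nat.pow_nonzero 2 N). lia.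
  - intros j.
    apply cv_ext with (fun N => half_pow (S N) ^ S K * ell (qexp (half_pow (S N) * (t + INR j)))
      + half_pow (S N) ^ S K * ell (qexp (half_pow (S N) * (t + (- INR (S j))%R)))).
    { intros N. rewrite RtoC_opp. change (t - INR (S j)) with (t + - INR (S j)). ring. }
    apply cv_plus; apply power_generating_pointwise; assumption.
  - intros N _. apply ell_distribution_centered; assumption.
Qed.

(** * Expansions of the lattice sum *)

Lemma Cpow_opp_even (z : C) (k : nat) : Nat.Even k -> (- z) ^ k = z ^ k.
Proof. intros [m ->]. rewrite !Cpow_mult_r. f_equal. simpl. ring. Qed.

(** The binomial series at [- h / u], after [u^(K+1)] has been factored out. *)
Lemma pole_expansion (K : nat) (u h : C) :
  u <> 0 -> (Cmod h < Cmod u)%R ->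
  cseries (fun n => binc K n * ((- (1)) ^ n * / u ^ (S K + n)) * h ^ n) (/ (u + h) ^ S K).
Proof.
  intros Hu Hh. pose proof (proj1 (Cmod_gt_0 u) Hu) as Hu0.
  assert (Hq : (Cmod (- (h / u)) < 1)%R).
  { rewrite Cmod_opp, Cmod_div by exact Hu.
    apply Rmult_lt_reg_r with (Cmod u); [exact Hu0|].
    unfold Rdiv. rewrite Rmult_assoc, Rinv_l; lra. }
  assert (Hs : u + h <> 0).
  { intros E. replace h with (- u) in Hh.
    - rewrite Cmod_opp in Hh; lra.
    - replace h with (u + h - u) by ring. rewrite E. ring. }
  replace (/ (u + h) ^ S K) with (/ u ^ S K * / (1 - - (h / u)) ^ S K).
  - eapply cseries_ext; [|apply cseries_scal, (binomial_series K _ Hq)].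
    intros n. cbv beta. rewrite Cpow_add_r.
    replace (- (h / u)) with (- (1) * h * / u) by (field; exact Hu).
    rewrite !Cpow_mult_l, Cpow_inv by exact Hu.
    pose proof (Cpow_nz u (S K) Hu). pose proof (Cpow_nz u n Hu). field. split; assumption.
  - pose proof (Cpow_nz _ (S K) Hs). pose proof (Cpow_nz _ (S K) Hu).
    replace (u + h) with (u * (1 - - (h / u))) by (field; exact Hu).
    rewrite Cpow_mult_l. field. split; [|exact H0].
    apply Cpow_nz. replace (1 - - (h / u)) with ((u + h) / u) by (field; exact Hu).
    intros E. apply Hs. replace (u + h) with (u * ((u + h) / u)) by (field; exact Hu).
    rewrite E. ring.
Qed.

(** The points [- j] and [S j] enumerate the integers once each. The explicit distance [d] supplies
    both the majorants and the radius [d / 2] of the Taylor expansions. *)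
Definition off_lattice (d : R) (z : C) : Prop :=
  (0 < d)%R /\ (forall j, (d <= Cmod (z + INR j))%R) /\ (forall j, (d <= Cmod (z - INR (S j)))%R).

Definition lattice_term (k : nat) (z : C) (j : nat) : C :=
  / (z + INR j) ^ k + / (z - INR (S j)) ^ k.

Definition lattice_sum (k : nat) (z : C) : C := Sum_from 0 (lattice_term k z).

Lemma ex_series_lattice_both (d : R) (z : C) (k : nat) :
  off_lattice d z -> (2 <= k)%nat ->
  ex_series (fun j => (/ Cmod (z + INR j)%C ^ k + / Cmod (z - INR (S j))%C ^ k)%R).
Proof.
  intros (Hd & H1 & H2) Hk.
  assert (E : forall j, Cmod (z - INR (S j)) = Cmod (1 - z + INR j)).
  { intros j. rewrite Cmod_dist_sym. f_equal. rewrite S_INR, RtoC_plus. ring. }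
  apply (@ex_series_plus R_AbsRing R_NormedModule).
  - exact (ex_series_lattice z d k Hd H1 Hk).
  - apply ex_series_ext with (fun j => (/ Cmod (1 - z + INR j)%C ^ k)%R).
    + intros j. rewrite E. reflexivity.
    + apply (ex_series_lattice _ d k Hd); [|exact Hk]. intros j. rewrite <- E. apply H2.
Qed.

Lemma off_lattice_neq (d : R) (z : C) :
  off_lattice d z -> (forall j, z + INR j <> 0) /\ (forall j, z - INR (S j) <> 0).
Proof.
  intros (Hd & H1 & H2).
  split; intros j; apply Cmod_gt_0; [specialize (H1 j)|specialize (H2 j)]; lra.
Qed.

Lemma Cmod_inv_pow (z : C) (k : nat) : z <> 0 -> Cmod (/ z ^ k) = (/ Cmod z ^ k)%R.
Proof. intros H. rewrite Cmod_inv, Cmod_pow by (apply Cpow_nz, H). reflexivity. Qed.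

Lemma Cmod_inv_pow_add (z : C) (d : R) (k n : nat) :
  (0 < d)%R -> (d <= Cmod z)%R -> (Cmod (/ z ^ (k + n)) <= / Cmod z ^ k * / d ^ n)%R.
Proof.
  intros Hd H. rewrite Cmod_inv_pow by (apply Cmod_gt_0; lra).
  rewrite pow_add, Rinv_mult. apply Rmult_le_compat_l.
  - left. apply Rinv_0_lt_compat, pow_lt. lra.
  - apply Rinv_le_contravar; [apply pow_lt, Hd|]. apply pow_incr. lra.
Qed.

Lemma lattice_sum_correct (d : R) (z : C) (k : nat) :
  off_lattice d z -> (2 <= k)%nat -> cseries (lattice_term k z) (lattice_sum k z).
Proof.
  intros Hz Hk. destruct (off_lattice_neq d z Hz) as [N1 N2].
  destruct (fun H => cseries_abs (lattice_term k z) _ H (ex_series_lattice_both d z k Hz Hk))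
    as [l Hl].
  - intros j. unfold lattice_term. eapply Rle_trans; [apply Cmod_triangle|].
    rewrite !Cmod_inv_pow by auto. lra.
  - unfold lattice_sum. rewrite (Sum_from_unique 0 _ l Hl). exact Hl.
Qed.

Lemma Cmod_m1_pow (n : nat) : Cmod ((- (1)) ^ n) = 1%R.
Proof. rewrite Cmod_pow, Cmod_m1, pow1. reflexivity. Qed.

Lemma off_lattice_near (d : R) (z w : C) :
  off_lattice d z -> (Cmod (w - z) < d / 2)%R -> off_lattice (d / 2) w.
Proof.
  intros (Hd & H1 & H2) Hw. repeat split.
  - lra.
  - intros j. specialize (H1 j).
    pose proof (Cmod_triangle (w + INR j) (- (w - z))) as T.
    replace (w + INR j + - (w - z)) with (z + INR j) in T by ring.
    rewrite Cmod_opp in T. lra.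
  - intros j. specialize (H2 j).
    pose proof (Cmod_triangle (w - INR (S j)) (- (w - z))) as T.
    replace (w - INR (S j) + - (w - z)) with (z - INR (S j)) in T by ring.
    rewrite Cmod_opp in T. lra.
Qed.

Lemma ex_series_binc_geom (K : nat) (x : R) :
  (0 <= x < 1)%R -> ex_series (fun n => (binc K n * x ^ n)%R).
Proof.
  intros Hx.
  apply ex_series_ext with (fun n => (Rabs (binc K n) * x ^ n)%R).
  - intros n. rewrite Rabs_pos_eq; [reflexivity|left; apply binc_pos].
  - apply poly_bounded_summable; [apply binc_poly_bounded|exact Hx].
Qed.

(** Each pole is expanded about [z] and the sums are exchanged: one factor [|z + m|^(-K-1)] makes
    the sum over the integers converge, and the other powers are at most [d^(-n)], so the majorant
    is a product. Halving [d] keeps [w] itself off the lattice. *)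
Lemma lattice_sum_expansion (K : nat) (d : R) (z w : C) :
  (1 <= K)%nat -> off_lattice d z -> (Cmod (w - z) < d / 2)%R ->
  cseries (fun n => Sum_from 0 (fun j => binc K n * (- (1)) ^ n * lattice_term (S K + n) z j)
                    * (w - z) ^ n) (lattice_sum (S K) w).
Proof.
  intros HK Hz Hw. pose proof (off_lattice_near d z w Hz Hw) as Hw'.
  destruct (off_lattice_neq d z Hz) as [N1 N2].
  pose proof Hz as (Hd & D1 & D2).
  pose proof (Cmod_ge_0 (w - z)) as Hr.
  assert (Hx : (0 <= Cmod (w - z) / d < 1)%R).
  { split.
    - apply Rmult_le_pos; [lra|left; apply Rinv_0_lt_compat; lra].
    - apply Rmult_lt_reg_r with d; [lra|]. unfold Rdiv. rewrite Rmult_assoc, Rinv_l; lra. }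
  apply (cseries_exchange
    (fun j n => binc K n * (- (1)) ^ n * lattice_term (S K + n) z j * (w - z) ^ n)
    (fun j => (/ Cmod (z + INR j)%C ^ S K + / Cmod (z - INR (S j))%C ^ S K)%R)
    (fun n => (binc K n * (Cmod (w - z)%C / d) ^ n)%R)
    (lattice_term (S K) w)).
  - intros j n. rewrite !Cmod_mult, Cmod_R, Cmod_m1_pow, Cmod_pow, Rmult_1_r.
    rewrite (Rabs_pos_eq (binc K n)) by (left; apply binc_pos).
    unfold Rdiv. rewrite Rpow_mult_distr, pow_inv.
    replace ((/ Cmod (z + INR j)%C ^ S K + / Cmod (z - INR (S j))%C ^ S K) *
      (binc K n * (Cmod (w - z)%C ^ n * / d ^ n)))%R with
      (binc K n * ((/ Cmod (z + INR j)%C ^ S K + / Cmod (z - INR (S j))%C ^ S K) * / d ^ n)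
        * Cmod (w - z)%C ^ n)%R by ring.
    apply Rmult_le_compat_r; [apply pow_le; exact Hr|].
    apply Rmult_le_compat_l; [left; apply binc_pos|].
    unfold lattice_term. eapply Rle_trans; [apply Cmod_triangle|].
    rewrite Rmult_plus_distr_r.
    apply Rplus_le_compat; apply Cmod_inv_pow_add; auto.
  - intros j. apply Rplus_le_le_0_compat; left; apply Rinv_0_lt_compat, pow_lt;
      apply Cmod_gt_0; auto.
  - intros n. apply Rmult_le_pos; [left; apply binc_pos|apply pow_le; lra].
  - apply (ex_series_lattice_both d); [exact Hz|lia].
  - apply ex_series_binc_geom, Hx.
  - intros j. unfold lattice_term.
    assert (P1 : (Cmod (w - z) < Cmod (z + INR j))%R) by (specialize (D1 j); lra).
    assert (P2 : (Cmod (w - z) < Cmod (z - INR (S j)))%R) by (specialize (D2 j); lra).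
    pose proof (cseries_plus _ _ _ _ (pole_expansion K _ _ (N1 j) P1)
                  (pole_expansion K _ _ (N2 j) P2)) as H.
    replace (z + INR j + (w - z)) with (w + INR j) in H by ring.
    replace (z - INR (S j) + (w - z)) with (w - INR (S j)) in H by ring.
    eapply cseries_ext; [|exact H]. intros n. cbv beta. ring.
  - intros n.
    assert (Hn : cseries (fun j => binc K n * (- (1)) ^ n * lattice_term (S K + n) z j)
               (binc K n * (- (1)) ^ n * lattice_sum (S K + n) z)).
    { apply cseries_scal, (lattice_sum_correct d); [exact Hz|lia]. }
    rewrite (Sum_from_unique 0 _ _ Hn), (Cmult_comm _ ((w - z) ^ n)).
    eapply cseries_ext; [|apply (cseries_scal ((w - z) ^ n) _ _ Hn)].
    intros j. cbv beta. ring.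
  - apply (lattice_sum_correct (d / 2)); [exact Hw'|lia].
Qed.

(** * Zeta values and the Laurent expansion at the origin *)

Definition zeta (s : nat) : R := Series (fun j => (/ INR (S j) ^ s)%R).

Lemma ex_series_zeta (s : nat) : (2 <= s)%nat -> ex_series (fun j => (/ INR (S j) ^ s)%R).
Proof.
  intros Hs. refine (@ex_series_le R_AbsRing R_CompleteNormedModule _ _ _ ex_series_inv_sq).
  intros j. change (Rabs (/ INR (S j) ^ s) <= / INR (S j) ^ 2)%R.
  assert (1 <= INR (S j))%R by (rewrite S_INR; pose proof (pos_INR j); lra).
  assert (0 < INR (S j) ^ 2)%R by (apply pow_lt; lra).
  rewrite Rabs_pos_eq by (left; apply Rinv_0_lt_compat, pow_lt; lra).
  apply Rinv_le_contravar; [assumption|]. apply Rle_pow; assumption.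
Qed.

Lemma psum_RtoC (a : nat -> R) (n : nat) :
  psum (fun i => RtoC (a i)) (S n) = sum_f_R0 a n.
Proof.
  induction n as [|n IH].
  - simpl. ring.
  - change (psum (fun i => RtoC (a i)) (S n) + a (S n) = sum_f_R0 a (S n)).
    rewrite IH, tech5, RtoC_plus. reflexivity.
Qed.

Lemma cseries_RtoC (a : nat -> R) (l : R) :
  cseries (fun n => RtoC (a n)) (RtoC l) <-> is_series a l.
Proof.
  rewrite cseries_lim. split.
  - intros H. apply is_series_Reals. intros e He. destruct (H e He) as [N HN].
    exists N. intros n Hn. specialize (HN (S n) ltac:(lia)).
    rewrite psum_RtoC, <- RtoC_minus, Cmod_R in HN. exact HN.
  - intros H e He. apply is_series_Reals in H. destruct (H e He) as [N HN].
    exists (S N). intros n Hn. destruct n as [|n]; [lia|].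
    rewrite psum_RtoC, <- RtoC_minus, Cmod_R. apply HN. lia.
Qed.

(** [lattice_term] pairs [- j] with [j + 1], whereas the expansion at [0] needs [m] paired with
    [- m]. The half with [z + j] converges by itself, so it alone can be shifted by one index, which
    releases the term [1 / z^k]. *)
Lemma lattice_sum_drop_pole (d : R) (z : C) (k : nat) :
  off_lattice d z -> (2 <= k)%nat ->
  cseries (fun j => / (z + INR (S j)) ^ k + / (z - INR (S j)) ^ k) (lattice_sum k z - / z ^ k).
Proof.
  intros Hz Hk. pose proof Hz as (Hd & D1 & D2).
  destruct (off_lattice_neq d z Hz) as [N1 N2].
  destruct (cseries_abs (fun j => / (z + INR j) ^ k) (fun j => (/ Cmod (z + INR j)%C ^ k)%R))
    as [l Hl].
  - intros j. rewrite Cmod_inv_pow by auto. lra.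
  - exact (ex_series_lattice z d k Hd D1 Hk).
  - pose proof (lattice_sum_correct d z k Hz Hk) as Hs.
    pose proof (cseries_minus _ _ _ _ Hs Hl) as Hm.
    pose proof (cseries_plus _ _ _ _ (cseries_incr _ _ Hl) Hm) as H.
    cbv beta in H.
    replace (l - / (z + INR 0) ^ k + (lattice_sum k z - l)) with (lattice_sum k z - / z ^ k) in H.
    + eapply cseries_ext; [|exact H]. intros j. unfold lattice_term. ring.
    + simpl (INR 0). replace (z + 0) with z by ring. ring.
Qed.

Lemma punctured_unit_disc_off_lattice (t : C) :
  punctured_unit_disc t -> off_lattice (Rmin (Cmod t) (1 - Cmod t)) t.
Proof.
  intros [H0 H1]. apply Cmod_gt_0 in H0.
  assert (P : forall (x : R) (j : nat), Rabs x = INR (S j) -> (1 - Cmod t <= Cmod (t + x))%R).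
  { intros x j Hx. pose proof (Cmod_triangle (t + x) (- t)) as T.
    replace (t + x + - t) with (RtoC x) in T by ring.
    rewrite Cmod_opp, Cmod_R, Hx, S_INR in T. pose proof (pos_INR j). lra. }
  repeat split.
  - apply Rmin_glb_lt; lra.
  - intros [|j].
    + simpl (INR 0). replace (t + 0) with t by ring. apply Rmin_l.
    + eapply Rle_trans; [apply Rmin_r|]. apply (P _ j). apply Rabs_pos_eq, pos_INR.
  - intros j. eapply Rle_trans; [apply Rmin_r|].
    replace (t - INR (S j)) with (t + (- INR (S j))%R) by (rewrite RtoC_opp; reflexivity).
    apply (P _ j). rewrite Rabs_Ropp. apply Rabs_pos_eq, pos_INR.
Qed.

Lemma upper_half_plane_off_lattice (t : C) : upper_half_plane t -> off_lattice (Im t) t.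
Proof.
  intros H. unfold upper_half_plane in H. repeat split; [exact H| |];
    intros j; (eapply Rle_trans; [|apply Im_le_Cmod]); (eapply Rle_trans; [|apply Rle_abs]);
    destruct t; simpl in *; lra.
Qed.

(** For even [S K], [(t - m)^(-S K) = (m - t)^(-S K)], so the expansions at [m] and [- m] differ
    only by [t -> - t]: odd powers cancel and even ones double. As [m >= 1], the majorant is
    geometric in [|t|] on the whole disc. *)
Lemma lattice_sum_laurent (K : nat) (t : C) :
  (1 <= K)%nat -> Nat.Even (S K) -> punctured_unit_disc t ->
  cseries (fun n => binc K n * (1 + (- (1)) ^ n) * zeta (S K + n) * t ^ n)
    (lattice_sum (S K) t - / t ^ S K).
Proof.
  intros HK HE Ht. pose proof (punctured_unit_disc_off_lattice t Ht) as Hoff.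
  pose proof (lattice_sum_drop_pole _ t (S K) Hoff ltac:(lia)) as HW.
  destruct Ht as [_ Ht]. pose proof (Cmod_ge_0 t) as Ht0.
  assert (Hj : forall j, (1 <= INR (S j))%R).
  { intros j. rewrite S_INR. pose proof (pos_INR j). lra. }
  assert (Nj : forall j, RtoC (INR (S j)) <> 0).
  { intros j. apply RtoC_neq_0. specialize (Hj j). lra. }
  assert (Mj : forall j, Cmod (INR (S j)) = INR (S j)).
  { intros j. rewrite Cmod_R. apply Rabs_pos_eq. specialize (Hj j). lra. }
  assert (Sg : forall n, (- t) ^ n = (- (1)) ^ n * t ^ n).
  { intros n. replace (- t) with (- (1) * t) by ring. apply Cpow_mult_l. }
  assert (S2 : forall n, (- (1)) ^ n * (- (1)) ^ n = 1).
  { intros n. rewrite <- Cpow_mult_l. replace (- (1) * - (1)) with (RtoC 1) by ring.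
    apply Cpow_1_l. }
  apply (cseries_exchange
    (fun j n => binc K n * (1 + (- (1)) ^ n) * / INR (S j) ^ (S K + n) * t ^ n)
    (fun j => (/ INR (S j) ^ S K)%R) (fun n => (2 * (binc K n * Cmod t ^ n))%R)
    (fun j => / (t + INR (S j)) ^ S K + / (t - INR (S j)) ^ S K)).
  - intros j n. rewrite !Cmod_mult, Cmod_R, Cmod_pow.
    rewrite (Rabs_pos_eq (binc K n)) by (left; apply binc_pos).
    assert (A1 : (Cmod (1 + (- (1)) ^ n) <= 2)%R).
    { eapply Rle_trans; [apply Cmod_triangle|]. rewrite Cmod_1, Cmod_m1_pow. lra. }
    assert (A2 : (Cmod (/ INR (S j) ^ (S K + n)) <= / INR (S j) ^ S K)%R).
    { eapply Rle_trans; [apply (Cmod_inv_pow_add _ 1); [lra|rewrite Mj; apply Hj]|].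
      rewrite Mj, pow1, Rinv_1. lra. }
    replace (/ INR (S j) ^ S K * (2 * (binc K n * Cmod t ^ n)))%R with
      (binc K n * 2 * / INR (S j) ^ S K * Cmod t ^ n)%R by ring.
    apply Rmult_le_compat_r; [apply pow_le; exact Ht0|].
    pose proof (binc_pos K n). pose proof (Cmod_ge_0 (1 + (- (1)) ^ n)).
    apply Rmult_le_compat; [apply Rmult_le_pos; lra|apply Cmod_ge_0| |exact A2].
    apply Rmult_le_compat_l; lra.
  - intros j. left. apply Rinv_0_lt_compat, pow_lt. specialize (Hj j). lra.
  - intros n. pose proof (binc_pos K n). pose proof (pow_le (Cmod t) n Ht0).
    apply Rmult_le_pos; [lra|]. apply Rmult_le_pos; lra.
  - apply ex_series_zeta. lia.
  - apply (@ex_series_scal_l R_AbsRing R_NormedModule 2%R), ex_series_binc_geom. lra.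
  - intros j.
    assert (P1 : (Cmod t < Cmod (INR (S j)))%R) by (rewrite Mj; specialize (Hj j); lra).
    assert (P2 : (Cmod (- t) < Cmod (INR (S j)))%R) by (rewrite Cmod_opp; exact P1).
    pose proof (cseries_plus _ _ _ _ (pole_expansion K _ _ (Nj j) P1)
                  (pole_expansion K _ _ (Nj j) P2)) as H.
    replace (/ (INR (S j) + - t) ^ S K) with (/ (t - INR (S j)) ^ S K) in H.
    + rewrite (Cplus_comm (INR (S j))) in H.
      eapply cseries_ext; [|exact H]. intros n. cbv beta. rewrite Sg.
      specialize (S2 n). symmetry. set (sg := (- (1)) ^ n) in *.
      transitivity (binc K n * (sg * sg + sg) * / INR (S j) ^ (S K + n) * t ^ n);
        [rewrite S2; reflexivity|].
      set (y := / INR (S j) ^ (S K + n)). ring.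
    + replace (INR (S j) + - t) with (- (t - INR (S j))) by ring.
      rewrite Cpow_opp_even by exact HE. reflexivity.
  - intros n. unfold zeta.
    pose proof (Series_correct _ (ex_series_zeta (S K + n) ltac:(lia))) as H.
    apply cseries_RtoC in H.
    apply (cseries_scal (binc K n * (1 + (- (1)) ^ n) * t ^ n)) in H.
    match goal with |- cseries _ ?x => match type of H with cseries _ ?y =>
      replace x with y by ring end end.
    eapply cseries_ext; [|exact H]. intros j. cbv beta.
    rewrite RtoC_inv, RtoC_pow by (apply pow_nonzero; specialize (Hj j); lra). ring.
  - exact HW.
Qed.

(** * The identity theorem *)

Lemma cseries_terms_bounded (a : nat -> C) (l : C) :
  cseries a l -> exists M : R, forall n, (Cmod (a n) <= M)%R.
Proof.
  intros H. rewrite cseries_lim in H. destruct (H 1%R ltac:(lra)) as [N HN].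
  exists (2 + sum_f_R0 (fun i => Cmod (a i)) N)%R. intros n.
  assert (Hp : forall m, (0 <= sum_f_R0 (fun i => Cmod (a i)) m)%R).
  { intros m. apply cond_pos_sum. intros; apply Cmod_ge_0. }
  destruct (le_lt_dec n N) as [Hn|Hn].
  - assert (Cmod (a n) <= sum_f_R0 (fun i => Cmod (a i)) N)%R; [|lra].
    clear HN. induction N as [|N IH].
    + replace n with 0%nat by lia. simpl. lra.
    + rewrite tech5. destruct (Nat.eq_dec n (S N)) as [->|].
      * specialize (Hp N). lra.
      * pose proof (Cmod_ge_0 (a (S N))). specialize (IH ltac:(lia)). lra.
  - pose proof (HN n ltac:(lia)) as H1. pose proof (HN (S n) ltac:(lia)) as H2.
    replace (a n) with ((psum a (S n) - l) + - (psum a n - l)) by (simpl; ring).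
    eapply Rle_trans; [apply Cmod_triangle|]. rewrite Cmod_opp. specialize (Hp N). lra.
Qed.

Lemma power_series_coef_zero (a : nat -> C) (r M : R) :
  (0 < r)%R -> (forall n, (Cmod (a n) * r ^ n <= M)%R) ->
  (forall eps : R, (0 < eps)%R ->
     exists w : C, w <> 0 /\ (Cmod w < eps)%R /\ cseries (fun n => a n * w ^ n) 0) ->
  forall n, a n = 0.
Proof.
  intros Hr HM Hz n. induction n as [n IH] using (well_founded_induction lt_wf).
  assert (HM0 : (0 <= M)%R).
  { eapply Rle_trans; [|apply (HM 0%nat)]. apply Rmult_le_pos; [apply Cmod_ge_0|simpl; lra]. }
  (* Once the lower coefficients vanish, dividing by [w^n] leaves [- a n] equal to a tail with terms
     at most [M / r^(n+1) * |w| * 2^(-i)] when [|w| < r / 2]. The factor [2] sums this geometric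
     series. *)
  set (D := (M / r ^ S n * 2)%R).
  assert (HrS : (0 < r ^ S n)%R) by (apply pow_lt, Hr).
  assert (HD : (0 <= D)%R).
  { apply Rmult_le_pos; [|lra]. apply Rmult_le_pos; [exact HM0|].
    left. apply Rinv_0_lt_compat, HrS. }
  apply Cmod_small_eq. intros e He. replace (a n - 0) with (a n) by ring.
  destruct (Hz (Rmin (r / 2) (e / (D + 1)))%R) as (w & Hw & Hwe & Hs).
  { apply Rmin_glb_lt; [lra|apply Rdiv_lt_0_compat; lra]. }
  assert (W1 : (Cmod w < r / 2)%R) by (eapply Rlt_le_trans; [exact Hwe|apply Rmin_l]).
  assert (W2 : (Cmod w < e / (D + 1))%R) by (eapply Rlt_le_trans; [exact Hwe|apply Rmin_r]).
  pose proof (Cmod_ge_0 w) as W0.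
  apply (cseries_shift _ _ n) in Hs.
  replace (psum (fun n => a n * w ^ n) n) with (RtoC 0) in Hs.
  2:{ symmetry. transitivity (psum (fun _ => 0) n).
      - apply psum_ext. intros i Hi. rewrite IH by exact Hi. ring.
      - clear. induction n as [|n IH]; simpl; [reflexivity|rewrite IH; ring]. }
  apply (cseries_scal (/ w ^ n)) in Hs.
  assert (Hs' : cseries (fun i => a (n + i)%nat * w ^ i) 0).
  { replace (RtoC 0) with (/ w ^ n * (0 - 0)) by ring.
    eapply cseries_ext; [|exact Hs]. intros i. cbv beta. rewrite Cpow_add_r.
    field. apply Cpow_nz, Hw. }
  apply cseries_incr in Hs'. rewrite Nat.add_0_r in Hs'.
  replace (0 - a n * w ^ 0) with (- a n) in Hs' by (simpl; ring).
  assert (B : (Cmod (- a n) <= Series (fun i => (M / r ^ S n * Cmod w) * (/ 2) ^ i))%R).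
  { eapply cseries_bound; [| |exact Hs'].
    - intros i. cbv beta. rewrite Cmod_mult, Cmod_pow.
      replace (n + S i)%nat with (S n + i)%nat by lia.
      specialize (HM (S n + i)%nat). rewrite pow_add in HM.
      assert (Hri : (0 < r ^ i)%R) by (apply pow_lt, Hr).
      assert (E1 : (Cmod (a (S n + i)%nat) <= M / r ^ S n * / r ^ i)%R).
      { apply Rmult_le_reg_r with (r ^ S n * r ^ i)%R; [apply Rmult_lt_0_compat; lra|].
        replace (M / r ^ S n * / r ^ i * (r ^ S n * r ^ i))%R with M; [exact HM|].
        field. lra. }
      assert (E2 : (Cmod w ^ i <= r ^ i * (/ 2) ^ i)%R).
      { rewrite <- Rpow_mult_distr. apply pow_incr. lra. }
      rewrite <- tech_pow_Rmult.
      apply Rle_trans with (M / r ^ S n * / r ^ i * (Cmod w * (r ^ i * (/ 2) ^ i)))%R.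
      + apply Rmult_le_compat; [apply Cmod_ge_0| |exact E1|].
        * apply Rmult_le_pos; [exact W0|apply pow_le, W0].
        * apply Rmult_le_compat_l; [exact W0|exact E2].
      + right. field. lra.
    - apply (@ex_series_scal_l R_AbsRing R_NormedModule (M / r ^ S n * Cmod w)%R).
      apply ex_series_geom. rewrite Rabs_pos_eq; lra. }
  rewrite Cmod_opp, Series_scal_l, Series_geom in B by (rewrite Rabs_pos_eq; lra).
  replace (M / r ^ S n * Cmod w * / (1 - / 2))%R with (D * Cmod w)%R in B
    by (unfold D; field; lra).
  apply Rle_trans with (1 := B).
  apply Rle_trans with (D * (e / (D + 1)))%R.
  - apply Rmult_le_compat_l; lra.
  - apply Rmult_le_reg_r with (D + 1)%R; [lra|].
    replace (D * (e / (D + 1)) * (D + 1))%R with (D * e)%R by (field; lra). nra.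
Qed.

(** The difference of the two local expansions vanishes at points accumulating at [z], so all its
    coefficients are zero. *)
Lemma analytic_on_eq_near (U : C -> Prop) (F G : C -> C) (z : C) :
  analytic_on U F -> analytic_on U G -> U z ->
  (forall eps : R, (0 < eps)%R ->
     exists w, w <> z /\ (Cmod (w - z) < eps)%R /\ F w = G w) ->
  exists r : R, (0 < r)%R /\ forall w, (Cmod (w - z) < r)%R -> F w = G w.
Proof.
  intros HF HG Hz Hacc.
  destruct (HF z Hz) as (a & r1 & Hr1 & Ha). destruct (HG z Hz) as (b & r2 & Hr2 & Hb).
  set (r := Rmin r1 r2). assert (Hr : (0 < r)%R) by (apply Rmin_glb_lt; assumption).
  assert (Hd : forall w, (Cmod (w - z) < r)%R ->
             cseries (fun n => (a n - b n) * (w - z) ^ n) (F w - G w)).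
  { intros w Hw.
    assert (W1 : (Cmod (w - z) < r1)%R) by (eapply Rlt_le_trans; [exact Hw|apply Rmin_l]).
    assert (W2 : (Cmod (w - z) < r2)%R) by (eapply Rlt_le_trans; [exact Hw|apply Rmin_r]).
    eapply cseries_ext; [|apply (cseries_minus _ _ _ _ (Ha w W1) (Hb w W2))].
    intros n. simpl. ring. }
  assert (H0 : forall n, a n - b n = 0).
  { assert (Hp : (Cmod (z + (r / 2)%R - z) < r)%R).
    { replace (z + (r / 2)%R - z) with (RtoC (r / 2)) by ring.
      rewrite Cmod_R, Rabs_pos_eq; lra. }
    destruct (cseries_terms_bounded _ _ (Hd _ Hp)) as [M HM].
    apply (power_series_coef_zero _ (r / 2) M); [lra| |].
    - intros n. specialize (HM n). cbv beta in HM.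
      replace (z + (r / 2)%R - z) with (RtoC (r / 2)) in HM by ring.
      rewrite Cmod_mult, Cmod_pow, Cmod_R, (Rabs_pos_eq (r / 2)) in HM by lra. exact HM.
    - intros e He. destruct (Hacc (Rmin e r)) as (w & Hw & Hwe & Hw0).
      { apply Rmin_glb_lt; assumption. }
      exists (w - z). split; [|split].
      + intros E. apply Hw. replace w with (w - z + z) by ring. rewrite E. ring.
      + eapply Rlt_le_trans; [exact Hwe|apply Rmin_l].
      + replace (RtoC 0) with (F w - G w) by (rewrite Hw0; ring). apply Hd.
        eapply Rlt_le_trans; [exact Hwe|apply Rmin_r]. }
  exists r. split; [exact Hr|]. intros w Hw.
  assert (E : F w - G w = 0).
  { apply (cseries_unique _ _ _ (Hd w Hw)).
    eapply cseries_ext; [|apply cseries_0]. intros n. cbv beta. rewrite H0. ring. }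
  replace (F w) with (F w - G w + G w) by ring. rewrite E. ring.
Qed.

(** Let [m] be the supremum of the parameters up to which both functions agree. The points below [m]
    accumulate at [p + m v], so agreement extends to a disc about it; [m < 1] would then contradict
    the supremum. *)
Lemma identity_on_segment (U : C -> Prop) (F G : C -> C) (p v : C) :
  (forall s : R, (0 <= s <= 1)%R -> U (p + s * v)) ->
  analytic_on U F -> analytic_on U G ->
  (exists e : R, (0 < e)%R /\ forall s : R, (0 <= s < e)%R -> F (p + s * v) = G (p + s * v)) ->
  F (p + v) = G (p + v).
Proof.
  intros HU HF HG (e & He & Hs0).
  destruct (classic (v = 0)) as [->|Hv].
  { specialize (Hs0 0%R ltac:(lra)). replace (p + 0 * 0) with (p + 0) in Hs0 by ring. exact Hs0. }
  apply Cmod_gt_0 in Hv.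
  set (E := fun s : R => (0 <= s <= 1)%R /\
              forall s' : R, (0 <= s' <= s)%R -> F (p + s' * v) = G (p + s' * v)).
  destruct (completeness E) as [m [Hub Hlub]].
  { exists 1%R. intros s [Hs _]. lra. }
  { exists 0%R. split; [lra|]. intros s' Hs'. apply Hs0. lra. }
  assert (Hm0 : (0 < m)%R).
  { apply Rlt_le_trans with (Rmin 1 (e / 2)); [apply Rmin_glb_lt; lra|].
    pose proof (Rmin_l 1 (e / 2)). pose proof (Rmin_r 1 (e / 2)).
    assert (0 < Rmin 1 (e / 2))%R by (apply Rmin_glb_lt; lra).
    apply Hub. split; [lra|]. intros s' Hs'. apply Hs0. lra. }
  assert (Hm1 : (m <= 1)%R) by (apply Hlub; intros s [Hs _]; lra).
  assert (Hbelow : forall s : R, (0 <= s < m)%R -> F (p + s * v) = G (p + s * v)).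
  { intros s Hs. apply NNPP. intros Hne.
    assert (m <= s)%R; [|lra]. apply Hlub. intros s1 [Hs1 H1].
    apply Rnot_lt_le. intros Hlt. apply Hne, H1. lra. }
  destruct (analytic_on_eq_near U F G (p + m * v) HF HG) as (r & Hr & Heq).
  { apply HU. lra. }
  { intros eps Heps.
    set (h := (Rmin m (eps / Cmod v) / 2)%R).
    assert (Hev : (0 < eps / Cmod v)%R) by (apply Rdiv_lt_0_compat; lra).
    assert (Hmin : (0 < Rmin m (eps / Cmod v))%R) by (apply Rmin_glb_lt; lra).
    pose proof (Rmin_l m (eps / Cmod v)). pose proof (Rmin_r m (eps / Cmod v)).
    assert (D : p + (m - h)%R * v - (p + m * v) = (- h)%R * v)
      by (rewrite RtoC_minus, RtoC_opp; ring).
    assert (Dm : Cmod (p + (m - h)%R * v - (p + m * v)) = (h * Cmod v)%R).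
    { rewrite D, Cmod_mult, Cmod_R, Rabs_Ropp, Rabs_pos_eq; [reflexivity|unfold h; lra]. }
    exists (p + (m - h)%R * v). split; [|split].
    - intros Ez. rewrite Ez in Dm.
      replace (p + m * v - (p + m * v)) with (RtoC 0) in Dm by ring.
      rewrite Cmod_0 in Dm. assert (0 < h * Cmod v)%R; [|lra].
      apply Rmult_lt_0_compat; [unfold h|]; lra.
    - rewrite Dm. apply Rlt_le_trans with (eps / Cmod v * Cmod v)%R.
      + apply Rmult_lt_compat_r; [exact Hv|unfold h; lra].
      + right. field. lra.
    - apply Hbelow. unfold h. lra. }
  assert (Hm : m = 1%R).
  { apply Rle_antisym; [exact Hm1|]. apply Rnot_lt_le. intros Hlt.
    set (h := (Rmin (1 - m) (r / Cmod v / 2))%R).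
    assert (Hrv : (0 < r / Cmod v)%R) by (apply Rdiv_lt_0_compat; lra).
    assert (Hh : (0 < h)%R) by (apply Rmin_glb_lt; lra).
    pose proof (Rmin_l (1 - m) (r / Cmod v / 2)) as M1. fold h in M1.
    pose proof (Rmin_r (1 - m) (r / Cmod v / 2)) as M2. fold h in M2.
    assert (E (m + h)%R); [|specialize (Hub _ H); lra].
    split; [lra|]. intros s Hs.
    destruct (Rlt_le_dec s m) as [Hsm|Hsm]; [apply Hbelow; lra|].
    apply Heq.
    replace (p + s * v - (p + m * v)) with ((s - m)%R * v) by (rewrite RtoC_minus; ring).
    rewrite Cmod_mult, Cmod_R, Rabs_pos_eq by lra.
    apply Rlt_le_trans with (r / Cmod v * Cmod v)%R.
    - apply Rmult_lt_compat_r; [exact Hv|lra].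
    - right. field. lra. }
  subst m. replace (p + v) with (p + 1 * v) by ring. apply Heq.
  replace (p + 1 * v - (p + 1 * v)) with (RtoC 0) by ring. rewrite Cmod_0. exact Hr.
Qed.

(** * Bernoulli numbers and zeta values *)

Lemma exp_neq_1 (x : R) : x <> 0%R -> (exp x - 1 <> 0)%R.
Proof.
  intros H E. apply H, exp_inv. rewrite exp_0. lra.
Qed.

Lemma bernoulli_real (B : nat -> R) :
  is_bernoulli B ->
  exists r : R, (0 < r)%R /\ forall x : R, x <> 0%R -> (Rabs x < r)%R ->
    is_series (fun n => (B n / INR (fact n) * x ^ n)%R) (x / (exp x - 1))%R.
Proof.
  intros (r & Hr & H). exists r. split; [exact Hr|]. intros x Hx Hxr.
  apply cseries_RtoC. pose proof (exp_neq_1 x Hx) as He.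
  specialize (H x (RtoC_neq_0 _ Hx) ltac:(rewrite Cmod_R; exact Hxr)).
  rewrite Cexp_R in H. rewrite RtoC_div, RtoC_minus by exact He.
  refine (cseries_ext _ _ _ _ H). intros n. simpl.
  rewrite RtoC_mult, RtoC_div, RtoC_pow by apply INR_fact_neq_0.
  field. apply RtoC_neq_0, INR_fact_neq_0.
Qed.

(** The series of [A - x A'] for [A = x / (e^x - 1)]. *)
Lemma bernoulli_derivative (B : nat -> R) :
  is_bernoulli B ->
  exists r : R, (0 < r)%R /\ forall x : R, (- r < x < 0)%R ->
    is_series (fun n => ((1 - INR n) * (B n / INR (fact n)) * x ^ n)%R)
      (x ^ 2 * exp x / (exp x - 1) ^ 2)%R.
Proof.
  intros HB. destruct (bernoulli_real B HB) as (r & Hr & H).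
  exists r. split; [exact Hr|]. intros x Hx.
  set (b := fun n => (B n / INR (fact n))%R).
  assert (Hps : forall y : R, y <> 0%R -> (Rabs y < r)%R -> PSeries b y = (y / (exp y - 1))%R).
  { intros y Hy Hyr. apply is_series_unique, (H y Hy Hyr). }
  assert (Hcv : Rbar_lt (Rabs x) (CV_radius b)).
  { assert (Hax : (Rabs x < r)%R) by (rewrite Rabs_left; lra).
    (* Convergence at a point strictly between [|x|] and [r] is what places [x] inside the radius of
       convergence. *)
    set (y := ((Rabs x + r) / 2)%R).
    assert (Hy : (0 < y)%R) by (unfold y; pose proof (Rabs_pos x); lra).
    apply Rbar_lt_le_trans with y; [simpl; unfold y; lra|].
    apply Rbar_not_lt_le. intros Hlt. apply (CV_disk_outside b y).
    - rewrite Rabs_pos_eq by lra. exact Hlt.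
    - apply ex_series_lim_0. exists (y / (exp y - 1))%R. apply H; [lra|].
      rewrite Rabs_pos_eq by lra. unfold y; lra. }
  pose proof (exp_neq_1 x ltac:(lra)) as He.
  assert (Hd : PSeries (PS_derive b) x
               = ((exp x - 1 - x * exp x) / (exp x - 1) ^ 2)%R).
  { rewrite <- Derive_PSeries by exact Hcv.
    rewrite (Derive_ext_loc _ (fun y => (y / (exp y - 1))%R)).
    - apply is_derive_unique. auto_derive; [exact He|]. field. exact He.
    (* The distances from [x] to [0] and to [- r]: the neighbourhood must avoid [0], which [Hps]
       excludes. *)
    - assert (Hd : (0 < Rmin (- x) (x + r))%R) by (apply Rmin_glb_lt; lra).
      exists (mkposreal _ Hd). intros y Hy.
      change (Rabs (y - x) < Rmin (- x) (x + r))%R in Hy.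
      pose proof (Rmin_l (- x) (x + r)). pose proof (Rmin_r (- x) (x + r)).
      apply Rabs_def2 in Hy. apply Hps; [lra|]. rewrite Rabs_left; lra. }
  pose proof (proj1 (ex_pseries_R _ _) (ex_pseries_derive b x Hcv)) as Hex.
  apply Series_correct in Hex. fold (PSeries (PS_derive b) x) in Hex. rewrite Hd in Hex.
  apply cseries_RtoC in Hex. apply (cseries_scal x) in Hex.
  pose proof (H x ltac:(lra) ltac:(rewrite Rabs_left; lra)) as Hb.
  apply cseries_RtoC in Hb.
  assert (Hx' : cseries (fun n => RtoC (INR n * b n * x ^ n)%R)
                  (x * ((exp x - 1 - x * exp x) / (exp x - 1) ^ 2)%R)).
  { match goal with |- cseries ?f ?l => replace l with (l + f 0%nat) end.
    - apply cseries_decr. eapply cseries_ext; [|exact Hex].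
      intros n. unfold PS_derive. rewrite <- RtoC_mult. f_equal.
      rewrite <- tech_pow_Rmult. ring.
    - cbv beta. simpl (INR 0). rewrite !Rmult_0_l. ring. }
  pose proof (cseries_minus _ _ _ _ Hb Hx') as Hm.
  rewrite <- RtoC_mult, <- RtoC_minus in Hm.
  apply cseries_RtoC.
  replace (x ^ 2 * exp x / (exp x - 1) ^ 2)%R with
    (x / (exp x - 1) - x * ((exp x - 1 - x * exp x) / (exp x - 1) ^ 2))%R
    by (field; exact He).
  eapply cseries_ext; [|exact Hm]. intros n. cbv beta. rewrite <- RtoC_minus.
  f_equal. unfold b. ring.
Qed.

Lemma power_generating_1 : power_generating 1 (fun q => q / (1 - q) ^ 2).
Proof.
  intros q Hq. pose proof (Cmod_lt_1_neq q Hq) as H1.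
  replace (q / (1 - q) ^ 2) with (q * / (1 - q) ^ 2 + (INR 0 ^ 1)%R * q ^ 0).
  - apply (cseries_decr (fun d => (INR d ^ 1)%R * q ^ d)).
    eapply cseries_ext; [|apply (cseries_scal q), (binomial_series 1 q Hq)].
    intros n. cbv beta. rewrite Cpow_S.
    replace (binc 1 n) with (INR (S n) ^ 1)%R; [ring|].
    unfold binc. rewrite Nat.add_1_r, fact_simpl, mult_INR. simpl (fact 1). simpl (INR 1).
    field. apply INR_fact_neq_0.
  - simpl (INR 0 ^ 1)%R. rewrite Rmult_0_l. field. exact H1.
Qed.

(** The [t] with [2 pi i t = x], so that [qexp t = e^x]; for [x < 0] it lies on the positive
    imaginary axis. *)
Definition zeta_arg (x : R) : C := x * / (2 * PI * Ci).

Lemma zeta_argK (x : R) : 2 * PI * Ci * zeta_arg x = x.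
Proof. unfold zeta_arg. field. pose proof two_pi_i_neq_0 as H. repeat split;
  intros E; apply H; rewrite E; ring. Qed.

Lemma zeta_arg_eq (x : R) : zeta_arg x = (0%R, (- x / (2 * PI))%R).
Proof.
  pose proof PI_RGT_0 as Hpi.
  transitivity (/ (2 * PI * Ci) * (2 * PI * Ci * (0%R, (- x / (2 * PI))%R))).
  - rewrite qexp_arg. unfold zeta_arg. rewrite Cmult_comm. f_equal.
    unfold RtoC. simpl. f_equal; field; lra.
  - field. repeat split; intros E; apply two_pi_i_neq_0; rewrite E; ring.
Qed.

Lemma lattice_sum_2 (x : R) : (x < 0)%R ->
  lattice_sum 2 (zeta_arg x) = (2 * PI * Ci) ^ 2 * (exp x / (exp x - 1) ^ 2)%R.
Proof.
  intros Hx. pose proof PI_RGT_0 as Hpi.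
  assert (Ht : (0 < Im (zeta_arg x))%R).
  { rewrite zeta_arg_eq. simpl. apply Rdiv_lt_0_compat; lra. }
  pose proof (lipschitz 1 _ (zeta_arg x) (le_n 1) power_generating_1 Ht) as H.
  pose proof (lattice_sum_correct _ _ 2
    (upper_half_plane_off_lattice _ Ht) (le_n 2)) as H'.
  rewrite (cseries_unique _ _ _ H' H).
  unfold qexp. rewrite zeta_argK, Cexp_R.
  pose proof (exp_neq_1 x ltac:(lra)) as He.
  rewrite RtoC_div, RtoC_pow, RtoC_minus by (apply pow_nonzero, He).
  assert (He' : RtoC (exp x) - 1 <> 0) by (rewrite <- RtoC_minus; apply RtoC_neq_0, He).
  simpl (INR (fact 1)). set (w := 2 * PI * Ci).
  assert (He'' : 1 - RtoC (exp x) <> 0).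
  { intros E. apply He'. replace (RtoC (exp x) - 1) with (- (1 - RtoC (exp x))) by ring.
    rewrite E. ring. }
  field. split; assumption.
Qed.

(** Two expansions of [x^2 e^x / (e^x - 1)^2] for small [x < 0] are compared: the differentiated
    Bernoulli series, and [t^2] times the Laurent series of the lattice sum of order two. *)
Lemma bernoulli_zeta_complex (B : nat -> R) (n : nat) :
  is_bernoulli B ->
  RtoC ((1 - INR (S (S n))) * (B (S (S n)) / INR (fact (S (S n)))))
    = binc 1 n * (1 + (- (1)) ^ n) * zeta (2 + n) * (/ (2 * PI * Ci)) ^ (2 + n).
Proof.
  intros HB. destruct (bernoulli_derivative B HB) as (r & Hr & H).
  pose proof PI_RGT_0 as Hpi. pose proof PI2_1 as Hpi1.
  set (kappa := / (2 * PI * Ci)).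
  set (al := fun n => ((1 - INR n) * (B n / INR (fact n)))%R).
  (* The coefficients of the difference. The [1] at index [0] is the pole term [t^2 / t^2]; index
     [1] is zero because [al 1] contains the factor [1 - 1]. *)
  set (d := fun n => match n with
     | 0 => al 0%nat - 1
     | 1 => RtoC 0
     | S (S m) => al (S (S m)) - binc 1 m * (1 + (- (1)) ^ m) * zeta (2 + m) * kappa ^ (2 + m)
     end).
  assert (Hd : forall x : R, (- Rmin r 1 < x < 0)%R -> cseries (fun n => d n * x ^ n) 0).
  { intros x Hx. pose proof (Rmin_l r 1). pose proof (Rmin_r r 1).
    assert (Hx0 : x <> 0%R) by lra.
    pose proof (RtoC_neq_0 x Hx0) as Hxc.
    pose proof (H x ltac:(lra)) as Ha. apply cseries_RtoC in Ha.
    apply cseries_incr, cseries_incr in Ha. cbv beta in Ha.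
    assert (Ht : punctured_unit_disc (zeta_arg x)).
    { split.
      - intros E. apply Hxc. rewrite <- (zeta_argK x), E. ring.
      - rewrite zeta_arg_eq.
        replace ((0, (- x / (2 * PI)))%R) with (Ci * (- x / (2 * PI))%R)
          by (unfold Ci, RtoC, Cmult; simpl; f_equal; ring).
        rewrite Cmod_mult, Cmod_Ci, Cmod_R, Rmult_1_l, Rabs_pos_eq.
        + apply Rmult_lt_reg_r with (2 * PI)%R; [lra|].
          unfold Rdiv. rewrite Rmult_assoc, Rinv_l; lra.
        + left. apply Rdiv_lt_0_compat; lra. }
    pose proof (lattice_sum_laurent 1 (zeta_arg x) (le_n 1)
      (ex_intro _ 1%nat eq_refl) Ht) as Hl.
    rewrite lattice_sum_2 in Hl by lra.
    apply (cseries_scal (zeta_arg x ^ 2)) in Hl.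
    pose proof (cseries_minus _ _ _ _ Ha Hl) as Hm.
    pose proof (exp_neq_1 x Hx0) as He.
    set (E := (exp x / (exp x - 1) ^ 2)%R) in *.
    match type of Hm with cseries _ ?l => set (L := l) in Hm end.
    replace (RtoC 0) with (L + d 1%nat * x ^ 1 + d 0%nat * x ^ 0).
    - apply (cseries_decr (fun n => d n * x ^ n)).
      apply (cseries_decr (fun n => d (S n) * x ^ S n)).
      eapply cseries_ext; [|exact Hm]. intros m. cbv beta. unfold d.
      rewrite RtoC_mult, RtoC_pow. fold (al (S (S m))). unfold zeta_arg. fold kappa.
      change (S (S m)) with (2 + m)%nat. rewrite !Cpow_add_r, !Cpow_mult_l.
      change (1 + 1)%nat with 2%nat. ring.
    - unfold L, d, al. simpl (INR 0). simpl (INR 1).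
      replace (x ^ 2 * exp x / (exp x - 1) ^ 2)%R with (x ^ 2 * E)%R
        by (unfold E; field; exact He).
      rewrite RtoC_mult, RtoC_pow.
      replace (zeta_arg x ^ 2 * ((2 * PI * Ci) ^ 2 * E - / zeta_arg x ^ 2)) with
        ((2 * PI * Ci * zeta_arg x) ^ 2 * E - 1).
      + rewrite zeta_argK. replace (1 - 1)%R with 0%R by ring.
        rewrite !Rmult_0_l, pow_O, Rmult_1_r. simpl. ring.
      + rewrite Cpow_mult_l. field. apply Ht. }
  assert (Hrho : (0 < Rmin r 1)%R) by (apply Rmin_glb_lt; lra).
  set (rho := Rmin r 1) in *.
  assert (D0 : d (S (S n)) = 0).
  { destruct (cseries_terms_bounded _ _ (Hd (- (rho / 2))%R ltac:(lra))) as [M HM].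
    apply (power_series_coef_zero d (rho / 2) M); [lra| |].
    - intros m. specialize (HM m). cbv beta in HM.
      rewrite Cmod_mult, Cmod_pow, Cmod_R, Rabs_Ropp, Rabs_pos_eq in HM by lra. exact HM.
    - intros e He.
      assert (Hm : (0 < Rmin rho e / 2)%R).
      { assert (0 < Rmin rho e)%R by (apply Rmin_glb_lt; lra). lra. }
      pose proof (Rmin_l rho e). pose proof (Rmin_r rho e).
      exists (RtoC (- (Rmin rho e / 2))%R). split; [|split].
      + apply RtoC_neq_0. lra.
      + rewrite Cmod_R, Rabs_Ropp, Rabs_pos_eq; lra.
      + apply Hd. lra. }
  unfold d in D0. fold (al (S (S n))).
  match goal with |- ?x = ?y => replace x with (x - y + y) by ring; rewrite D0; ring end.
Qed.

(** Euler's formula. At index [2d] the factor [binc 1 (2d-2) = 2d - 1] cancels [1 - 2d] up to sign;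
    this sign and [i^(-2d) = (-1)^d] combine to [(-1)^(d+1)]. *)
Lemma bernoulli_even (B : nat -> R) (d : nat) :
  is_bernoulli B -> (1 <= d)%nat ->
  B (2 * d)%nat
    = ((-1) ^ (d + 1) * (2 * INR (fact (2 * d)) * zeta (2 * d) / (2 * PI) ^ (2 * d)))%R.
Proof.
  intros HB Hd. set (m := (2 * (d - 1))%nat).
  pose proof (bernoulli_zeta_complex B m HB) as H.
  pose proof PI_RGT_0 as Hpi.
  assert (P2 : ((2 * PI) ^ (2 * d) <> 0)%R) by (apply pow_nonzero; lra).
  change (S (S m)) with (2 + m)%nat in H.
  replace (2 + m)%nat with (2 * d)%nat in H by (unfold m; lia).
  replace ((- (1)) ^ m) with (RtoC 1) in H.
  2:{ unfold m. rewrite Cpow_mult_r. replace ((- (1)) ^ 2) with (RtoC 1) by (simpl; ring).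
      symmetry. apply Cpow_1_l. }
  replace ((/ (2 * PI * Ci)) ^ (2 * d)) with (RtoC ((-1) ^ d * / (2 * PI) ^ (2 * d))) in H.
  2:{ rewrite (Cpow_mult_r (/ (2 * PI * Ci))), (pow_mult (2 * PI)), <- pow_inv,
        <- Rpow_mult_distr, RtoC_pow. f_equal.
      assert (Hc : RtoC (2 * PI) <> 0) by (apply RtoC_neq_0; lra).
      rewrite RtoC_mult, RtoC_inv, RtoC_pow by (apply pow_nonzero; lra).
      rewrite Cpow_inv by apply two_pi_i_neq_0. rewrite <- RtoC_mult.
      assert (HC2 : Ci * Ci = - (1)) by (unfold Ci, Cmult, Copp, RtoC; simpl; f_equal; ring).
      replace ((RtoC (2 * PI) * Ci) ^ 2) with (RtoC (2 * PI) ^ 2 * (Ci * Ci)) by (simpl; ring).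
      replace (RtoC (-1)) with (- (1)) by (unfold Copp, RtoC; simpl; f_equal; ring).
      rewrite HC2. field. exact Hc. }
  assert (Hb : binc 1 m = (INR (2 * d) - 1)%R).
  { unfold binc. rewrite Nat.add_1_r, fact_simpl, mult_INR.
    replace (INR (2 * d)) with (INR (S m) + 1)%R
      by (rewrite <- S_INR; f_equal; unfold m; lia).
    simpl (fact 1). simpl (INR 1). field. apply INR_fact_neq_0. }
  rewrite <- RtoC_plus, <- !RtoC_mult, Hb in H. apply RtoC_inj in H.
  assert (H1 : (INR (2 * d) - 1 <> 0)%R).
  { assert (2 <= INR (2 * d))%R; [|lra].
    replace 2%R with (INR 2) by (simpl; ring). apply le_INR. lia. }
  assert (Hf : (INR (fact (2 * d)) <> 0)%R) by apply INR_fact_neq_0.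
  replace ((1 - INR (2 * d)) * (B (2 * d)%nat / INR (fact (2 * d))))%R with
    ((INR (2 * d) - 1) * - (B (2 * d)%nat / INR (fact (2 * d))))%R in H by ring.
  rewrite !Rmult_assoc in H. apply Rmult_eq_reg_l in H; [|exact H1].
  rewrite pow_add.
  transitivity (- INR (fact (2 * d)) * - (B (2 * d)%nat / INR (fact (2 * d))))%R;
    [field; exact Hf|].
  rewrite H. field. exact P2.
Qed.

(** * The continuation *)

Lemma Li_power_generating (K : nat) : (1 <= K)%nat ->
  power_generating K (Li (- Z.of_nat K)).
Proof.
  intros HK q Hq. unfold Li.
  destruct (pclass_generating _ _ _ (pclass_pow K)) as (P & M & _ & HP).
  specialize (HP q Hq). set (l := P q / (1 - q) ^ S K) in *.
  assert (H : is_sum_from 1 (fun n => q ^ n / powerRZ (INR n) (- Z.of_nat K)) l).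
  (* [Li] starts at index [1]; the term of index [0] in the generating series vanishes because
     [0^K = 0] for [K >= 1]. *)
  { apply cseries_incr in HP.
    replace (l - (INR 0 ^ K)%R * q ^ 0) with l in HP.
    - refine (cseries_ext _ _ _ _ HP). intros n. simpl (1 + n)%nat.
      assert (HS : (INR (S n) <> 0)%R) by (apply not_0_INR; lia).
      rewrite powerRZ_neg', <- pow_powerRZ.
      pose proof (pow_nonzero _ K HS) as HSK.
      rewrite RtoC_inv by exact HSK. field. apply RtoC_neq_0, HSK.
    - rewrite pow_i by lia. ring. }
  rewrite (Sum_from_unique _ _ _ H). exact HP.
Qed.

Lemma open_upper_or_punctured :
  @open C_UniformSpace (fun t => upper_half_plane t \/ punctured_unit_disc t).
Proof.
  assert (B : forall (x y : C) (e : posreal), @ball C_UniformSpace x e y ->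
            (Rabs (Re y - Re x) < e)%R /\ (Rabs (Im y - Im x) < e)%R).
  { intros x y e [H1 H2]. split; assumption. }
  refine (fun t : C => _). intros [Ht|[Ht0 Ht1]].
  - exists (mkposreal _ Ht). intros y Hy. left. destruct (B _ _ _ Hy) as [_ H].
    simpl in H. apply Rabs_def2 in H. unfold upper_half_plane. lra.
  - apply Cmod_gt_0 in Ht0.
    (* Balls of [C_UniformSpace] are squares, and [|y - t|] is at most the sum of the two coordinate
       distances, hence the half. *)
    assert (He : (0 < Rmin (Cmod t) (1 - Cmod t) / 2)%R).
    { assert (0 < Rmin (Cmod t) (1 - Cmod t))%R by (apply Rmin_glb_lt; lra). lra. }
    exists (mkposreal _ He). refine (fun (y : C) Hy => _). right. destruct (B _ _ _ Hy) as [H1 H2].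
    simpl in H1, H2.
    assert (Hd : (Cmod (y - t) < Rmin (Cmod t) (1 - Cmod t))%R).
    { replace (y - t) with (RtoC (Re y - Re t) + Ci * RtoC (Im y - Im t)).
      - eapply Rle_lt_trans; [apply Cmod_triangle|].
        rewrite Cmod_mult, Cmod_Ci, !Cmod_R. lra.
      - apply injective_projections; simpl; unfold Re, Im; ring. }
    pose proof (Rmin_l (Cmod t) (1 - Cmod t)). pose proof (Rmin_r (Cmod t) (1 - Cmod t)).
    split.
    + intros E. rewrite E in Hd. replace (0 - t) with (- t) in Hd by ring.
      rewrite Cmod_opp in Hd. lra.
    + pose proof (Cmod_triangle (y - t) t) as T.
      replace (y - t + t) with y in T by ring. lra.
Qed.

Lemma analytic_on_scal_lattice_sum (c : C) (K : nat) :
  (1 <= K)%nat ->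
  analytic_on (fun t => upper_half_plane t \/ punctured_unit_disc t)
    (fun t => c * lattice_sum (S K) t).
Proof.
  intros HK z Hz.
  assert (exists d, off_lattice d z) as [d Hd].
  { destruct Hz as [Hz|Hz]; eexists.
    - exact (upper_half_plane_off_lattice z Hz).
    - exact (punctured_unit_disc_off_lattice z Hz). }
  exists (fun n => c * Sum_from 0 (fun j => binc K n * (- (1)) ^ n * lattice_term (S K + n) z j)),
    (d / 2)%R.
  split; [destruct Hd; lra|]. intros w Hw.
  pose proof (cseries_scal c _ _ (lattice_sum_expansion K d z w HK Hd Hw)) as H.
  refine (cseries_ext _ _ _ _ H). intros n. simpl (0 + n)%nat. ring.
Qed.

(** For [t] on the imaginary axis the segment leaves [t] obliquely, to avoid the pole
    at [0]. *)
Lemma segment_to_upper_half_plane (t : C) :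
  punctured_unit_disc t ->
  exists p : C, upper_half_plane p /\ forall s : R, (0 <= s <= 1)%R ->
    upper_half_plane (p + s * (t - p)) \/ punctured_unit_disc (p + s * (t - p)).
Proof.
  intros [Ht0 Ht1]. destruct t as [a b].
  assert (Hsq : (a ^ 2 + b ^ 2 < 1)%R).
  { change (Re (a, b) ^ 2 + Im (a, b) ^ 2 < 1)%R. rewrite <- Cmod2_alt. pose proof (Cmod_ge_0 (a, b)). nra. }
  assert (Hlow : forall x y : R, (x <> 0 \/ y <> 0)%R -> (x ^ 2 + y ^ 2 < 1)%R ->
            punctured_unit_disc (x, y)).
  { intros x y Hxy H. split.
    - intros E. injection E as E1 E2. lra.
    - apply Rsqr_incrst_0; [|apply Cmod_ge_0|lra].
      rewrite Rsqr_1, Rsqr_pow2, Cmod2_alt. exact H. }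
  set (p1 := if Req_EM_T a 0 then 1%R else a).
  exists (p1, 1%R). split; [unfold upper_half_plane; simpl; lra|].
  intros s Hs.
  replace ((p1, 1%R) + s * ((a, b) - (p1, 1%R))) with ((p1 + s * (a - p1))%R, (1 + s * (b - 1))%R)
    by (unfold Cmult, Cplus, Cminus, Copp, RtoC; simpl; f_equal; ring).
  destruct (Rlt_le_dec 0 (1 + s * (b - 1))) as [Hp|Hp]; [left; exact Hp|right].
  assert (Hb : (b <= 0)%R) by nra.
  assert (Hv : (b <= 1 + s * (b - 1))%R) by nra.
  unfold p1. destruct (Req_EM_T a 0) as [->|Ha].
  - apply Hlow.
    + destruct (Req_dec s 1) as [->|Hs1]; [|left; lra]. right.
      intros E. apply Ht0. unfold RtoC. f_equal. lra.
    (* Here [x >= 0 >= y], so [x^2 + y^2 <= (x - y)^2 <= b^2 < 1]. *)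
    + set (x := (1 + s * (0 - 1))%R). set (y := (1 + s * (b - 1))%R) in *.
      assert (0 <= x)%R by (unfold x; lra).
      assert (x - y <= - b)%R by (unfold x, y; nra).
      assert (0 <= x - y)%R by lra. nra.
  - apply Hlow.
    + left. replace (a + s * (a - a))%R with a by ring. exact Ha.
    + replace (a + s * (a - a))%R with a by ring. nra.
Qed.

Lemma segment_starts_in_upper_half_plane (p v : C) :
  upper_half_plane p ->
  exists e : R, (0 < e)%R /\ forall s : R, (0 <= s < e)%R -> upper_half_plane (p + s * v).
Proof.
  unfold upper_half_plane. intros Hp. pose proof (Rabs_pos (Im v)) as Hv.
  exists (Im p / (Rabs (Im v) + 1))%R. split; [apply Rdiv_lt_0_compat; lra|].
  intros s Hs. replace (Im (p + s * v)) with (Im p + s * Im v)%R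
    by (destruct p, v; simpl; ring).
  assert (s * (Rabs (Im v) + 1) < Im p)%R.
  { replace (Im p) with (Im p / (Rabs (Im v) + 1) * (Rabs (Im v) + 1))%R by (field; lra).
    apply Rmult_lt_compat_r; lra. }
  assert (- (s * Rabs (Im v)) <= s * Im v)%R.
  { pose proof (Rle_abs (- Im v)) as T. rewrite Rabs_Ropp in T. nra. }
  lra.
Qed.

(** The prefactor of the polylogarithm divided by Lipschitz' factor [(- 2 pi i)^(2g-2) / (2g-3)!];
    both carry the sign [(-1)^(g-1)], which cancels. *)
Definition free_energy_coef (B : nat -> R) (g : nat) : C :=
  B (2 * g)%nat * INR (fact (2 * g - 3)) / (INR (2 * g) * INR (fact (2 * g - 2)))
  * / (2 * PI) ^ (2 * g - 2).

Lemma neg_two_pi_i_pow (g : nat) : (1 < g)%nat ->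
  (- (2 * PI * Ci)) ^ (2 * g - 2) = (-1) ^ (g - 1) * (2 * PI) ^ (2 * g - 2).
Proof.
  intros Hg. replace (2 * g - 2)%nat with (2 * (g - 1))%nat by lia.
  rewrite !Cpow_mult_r, <- Cpow_mult_l. f_equal.
  assert (HC2 : Ci * Ci = -1) by (unfold Ci, Cmult, RtoC; simpl; f_equal; ring).
  rewrite <- HC2. simpl. ring.
Qed.

Lemma m1_pow_sqr (n : nat) : RtoC (-1) ^ n * RtoC (-1) ^ n = 1.
Proof.
  rewrite <- Cpow_mult_l. replace (RtoC (-1) * RtoC (-1)) with (RtoC 1).
  - apply Cpow_1_l.
  - rewrite <- RtoC_mult. f_equal. ring.
Qed.

Lemma Ftilde_lattice_sum (B : nat -> R) (g : nat) (t : C) :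
  (1 < g)%nat -> upper_half_plane t ->
  Ftilde B g t = free_energy_coef B g * lattice_sum (2 * g - 2) t.
Proof.
  intros Hg Ht. unfold Ftilde, free_energy_coef.
  set (K := (2 * g - 3)%nat). assert (HK : (1 <= K)%nat) by (unfold K; lia).
  replace (3 - 2 * Z.of_nat g)%Z with (- Z.of_nat K)%Z by (unfold K; lia).
  pose proof (lipschitz K _ t HK (Li_power_generating K HK) Ht) as H.
  pose proof (lattice_sum_correct _ _ (S K) (upper_half_plane_off_lattice t Ht) ltac:(lia)) as H'.
  pose proof (cseries_unique _ _ _ H' H) as E. fold (qexp t).
  replace (S K) with (2 * g - 2)%nat in E by (unfold K; lia).
  rewrite E, neg_two_pi_i_pow by exact Hg.
  pose proof (m1_pow_sqr (g - 1)) as S2.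
  assert (Hpi : (2 * PI) ^ (2 * g - 2) <> 0).
  { apply Cpow_nz. rewrite <- RtoC_mult. apply RtoC_neq_0. pose proof PI_RGT_0. lra. }
  assert (H1 : RtoC (INR (2 * g)) <> 0) by (apply RtoC_neq_0, not_0_INR; lia).
  assert (H2 : RtoC (INR (fact (2 * g - 2))) <> 0) by (apply RtoC_neq_0, INR_fact_neq_0).
  assert (H3 : RtoC (INR (fact K)) <> 0) by (apply RtoC_neq_0, INR_fact_neq_0).
  set (s := (-1) ^ (g - 1)) in *. set (P := (2 * PI) ^ (2 * g - 2)) in *.
  set (L := Li _ _). clearbody s P L.
  field. auto.
Qed.

(** Euler's formula cancels the sign [(-1)^(d+1)]. With [n = 2d - 2g + 2] and [K = 2g - 3] one has
    [n + K = 2d - 1], so [(2d)! / (2d n!)] equals [K!] times the binomial coefficient. *)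
Lemma small_t_term_zeta (B : nat -> R) (g : nat) (t : C) (d : nat) :
  is_bernoulli B -> (1 < g)%nat -> (g <= d)%nat ->
  small_t_term B g t d
    = INR (fact (2 * g - 3)) / (2 * PI) ^ (2 * g - 2)
      * (binc (2 * g - 3) (2 * d - 2 * g + 2) * 2 * zeta (2 * d) * t ^ (2 * d - 2 * g + 2)).
Proof.
  intros HB Hg Hd. unfold small_t_term.
  rewrite (bernoulli_even B d HB) by lia.
  set (n := (2 * d - 2 * g + 2)%nat). set (K := (2 * g - 3)%nat).
  assert (H1 : (INR (2 * d) <> 0)%R) by (apply not_0_INR; lia).
  assert (H2 : (INR (fact n) <> 0)%R) by apply INR_fact_neq_0.
  assert (H3 : (INR (fact K) <> 0)%R) by apply INR_fact_neq_0.
  assert (Hpi : (2 * PI <> 0)%R) by (pose proof PI_RGT_0; lra).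
  assert (Hf : INR (fact (2 * d)) = (INR (2 * d) * (binc K n * (INR (fact n) * INR (fact K))))%R).
  { unfold binc. replace (fact (2 * d)) with (2 * d * fact (n + K))%nat.
    - rewrite mult_INR. field. auto.
    - replace (2 * d)%nat with (S (n + K)) by (unfold n, K; lia). reflexivity. }
  assert (Hp : ((2 * PI) ^ (2 * d) = (2 * PI) ^ n * (2 * PI) ^ (2 * g - 2))%R).
  { rewrite <- pow_add. f_equal. unfold n. lia. }
  pose proof (pow_nonzero _ n Hpi) as P1. pose proof (pow_nonzero _ (2 * g - 2) Hpi) as P2.
  assert (S2 : ((-1) ^ (d + 1) * (-1) ^ (d + 1) = 1)%R).
  { rewrite <- Rpow_mult_distr. replace (-1 * -1)%R with 1%R by ring. apply pow1. }
  rewrite Hf, Hp, <- (RtoC_mult 2 PI), Cpow_mult_l, <- !RtoC_pow.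
  set (s := ((-1) ^ (d + 1))%R) in *.
  set (p := ((2 * PI) ^ n)%R) in *. set (p' := ((2 * PI) ^ (2 * g - 2))%R) in *.
  assert (H4 : (INR (2 * d) * INR (fact n) <> 0)%R)
    by (apply Rmult_integral_contrapositive_currified; assumption).
  rewrite <- !RtoC_mult, <- !RtoC_div by assumption.
  rewrite !Cmult_assoc, <- !RtoC_mult. f_equal. f_equal.
  transitivity (s * s * (INR (fact K) / p' * (binc K n * 2 * zeta (2 * d))))%R;
    [|rewrite S2; ring].
  field. auto.
Qed.

Theorem theorem4p6 (B : nat -> R) (HB : is_bernoulli B) (g : nat)
    (hg : (1 < g)%nat) :
  let U := fun t : C => upper_half_plane t \/ punctured_unit_disc t in
  (exists F : C -> C,
     analytic_continuation upper_half_plane (Ftilde B g) U F) /\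
  (forall F : C -> C,
     analytic_continuation upper_half_plane (Ftilde B g) U F ->
     forall t : C, punctured_unit_disc t ->
       converges_from g (small_t_term B g t) /\
       F t =
         B (2 * g)%nat / (INR (2 * g) * INR (2 * g - 2))
           * (1 / (2 * PI * t) ^ (2 * g - 2))
         + (-1) ^ g
           * ((B (2 * g)%nat * B (2 * g - 2)%nat)
              / (INR (2 * g) * INR (2 * g - 2) * INR (fact (2 * g - 2))))
         + B (2 * g)%nat / (INR (2 * g) * INR (fact (2 * g - 2)))
           * Sum_from g (small_t_term B g t)).
Proof.
  intros U.
  set (K := (2 * g - 3)%nat). assert (HK : (1 <= K)%nat) by (unfold K; lia).
  assert (EK : S K = (2 * g - 2)%nat) by (unfold K; lia).
  (* The continuation itself: [S K = 2g - 2 >= 2] makes the lattice sum converge absolutely, also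
     below the real axis. *)
  set (G := fun t => free_energy_coef B g * lattice_sum (S K) t).
  assert (HG : analytic_continuation upper_half_plane (Ftilde B g) U G).
  { split; [exact open_upper_or_punctured|]. split; [intros z Hz; left; exact Hz|].
    split; [apply analytic_on_scal_lattice_sum, HK|].
    intros z Hz. unfold G. rewrite EK. symmetry. apply Ftilde_lattice_sum; assumption. }
  split; [exists G; exact HG|].
  intros F (_ & _ & HF & HFeq) t Ht.
  destruct HG as (_ & _ & HG & HGeq).
  assert (EF : F t = G t).
  { destruct (segment_to_upper_half_plane t Ht) as (p & Hp & Hseg).
    replace t with (p + (t - p)) by ring.
    apply (identity_on_segment U); [exact Hseg|exact HF|exact HG|].
    destruct (segment_starts_in_upper_half_plane p (t - p) Hp) as (e & He & Hs).
    exists e. split; [exact He|]. intros s Hse. rewrite HFeq, HGeq by auto. reflexivity. }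
  assert (HE : Nat.Even (S K)) by (exists (g - 1)%nat; lia).
  pose proof (lattice_sum_laurent K t HK HE Ht) as HL.
  assert (M1 : forall n, (- (1)) ^ (2 * n) = 1).
  { intros n. rewrite Cpow_mult_r. replace ((- (1)) ^ 2) with (RtoC 1) by (simpl; ring).
    apply Cpow_1_l. }
  apply cseries_even in HL.
  2:{ intros n. rewrite Nat.add_1_r, (Cpow_S (- (1))), M1. ring. }
  set (W := lattice_sum (S K) t - / t ^ S K) in HL.
  assert (HL0 : cseries (fun j => binc K (2 * j) * 2 * zeta (S K + 2 * j) * t ^ (2 * j)) W).
  { eapply cseries_ext; [|exact HL]. intros j. cbv beta. rewrite M1. ring. }
  (* Removes the constant coefficient [2 zeta (2g-2)]; the remaining index [S j] corresponds to
     [d = g + j]. *)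
  clear HL. apply cseries_incr in HL0. cbv beta in HL0.
  rewrite Nat.mul_0_r, Nat.add_0_r, binc_0_r in HL0.
  set (c := INR (fact K) / (2 * PI) ^ (2 * g - 2)).
  apply (cseries_scal c) in HL0.
  assert (HS : is_sum_from g (small_t_term B g t) (c * (W - 1 * 2 * zeta (S K) * t ^ 0))).
  { refine (cseries_ext _ _ _ _ HL0). intros j. cbv beta.
    rewrite small_t_term_zeta by (auto; lia). fold K. fold c.
    replace (2 * (g + j) - 2 * g + 2)%nat with (2 * S j)%nat by lia.
    replace (2 * (g + j))%nat with (S K + 2 * S j)%nat by (unfold K; lia).
    reflexivity. }
  split; [eexists; exact HS|].
  rewrite (Sum_from_unique _ _ _ HS), EF. unfold G, free_energy_coef.
  fold K. replace (lattice_sum (S K) t) with (W + / t ^ S K) by (unfold W; ring).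
  (* Turns the constant coefficient into [B_(2g-2)]; the exponent [(g-1) + 1] produces the sign
     [(-1)^g] of the middle summand. *)
  pose proof (bernoulli_even B (g - 1) HB ltac:(lia)) as HBe.
  replace (2 * (g - 1))%nat with (2 * g - 2)%nat in HBe by lia.
  replace (g - 1 + 1)%nat with g in HBe by lia.
  rewrite EK in *. rewrite HBe.
  assert (Hpi : (2 * PI <> 0)%R) by (pose proof PI_RGT_0; lra).
  pose proof (pow_nonzero _ (2 * g - 2) Hpi) as HP.
  assert (Hk : (INR (2 * g - 2) <> 0)%R) by (apply not_0_INR; lia).
  assert (Hg2 : (INR (2 * g) <> 0)%R) by (apply not_0_INR; lia).
  assert (HfK : (INR (fact K) <> 0)%R) by apply INR_fact_neq_0.
  assert (Hf : INR (fact (2 * g - 2)) = (INR (2 * g - 2) * INR (fact K))%R).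
  { rewrite <- mult_INR. f_equal. rewrite <- EK. reflexivity. }
  assert (Htk : t ^ (2 * g - 2) <> 0) by (apply Cpow_nz, Ht).
  unfold c. rewrite Hf, (Cpow_mult_l (2 * PI) t), !RtoC_mult, RtoC_div, !RtoC_mult,
    !RtoC_pow, !RtoC_mult by assumption.
  pose proof (m1_pow_sqr g) as S2.
  apply RtoC_neq_0 in HP, Hk, Hg2, HfK, Hpi. rewrite !RtoC_pow, RtoC_mult in HP.
  set (s := RtoC (-1) ^ g) in *. set (P := (RtoC 2 * RtoC PI) ^ (2 * g - 2)) in *.
  set (b := RtoC (B (2 * g)%nat)). set (z := RtoC (zeta (2 * g - 2))).
  set (T := t ^ (2 * g - 2)) in *. clearbody W s P T b z. simpl (t ^ 0).
  (* The sign in the statement meets the one from Euler's formula. Writing their product as [s * s]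
     lets [S2] replace it by [1], a relation [field] cannot find. *)
  match goal with |- ?l = ?a + s * ?x + ?y =>
    transitivity (a + s * s * (b * 2 * z * INR (fact K) / (INR (2 * g) * INR (2 * g - 2) * INR (fact K) * P)) + y);
    [rewrite S2|] end; field; auto.
Qed.
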